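(* There is a randomized algorithm which, given $n$ and the number of edges $m \ge 1$ of an undirected graph $G$ on $n$ vertices, accessed only via uniform vertex queries, degree queries, and neighbor queries, returns an edge of $G$ that is distributed exactly uniformly over the edges of $G$ (each directed edge, i.e. each ordered pair $(u,v)$ with $\{u,v\}\in E$, being returned with probability exactly $\frac{1}{2m}$), and whose expected number of queries (and expected running time) is $O(n/\sqrt{m})$.
   Context: The graph $G=(V,E)$ has its vertices labeled arbitrarily by $[n]$ and the neighbors of each vertex $v$ labeled arbitrarily by $[d(v)]$. The algorithm knows $n$ and $m$ and may use the following queries: uniform vertex queries (given $i\in[n]$, return the $i$-th vertex), degree queries (given a vertex $v$, return its degree $d(v)$), and neighbor queries (given a vertex $v$ and $j\in[d(v)]$, return the $j$-th neighbor of $v$). The algorithm may use its own randomness. *)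

(* Defs.v *)
From HB Require Import structures.
From mathcomp Require Import all_boot all_order all_algebra.
From mathcomp Require Import all_classical all_reals all_analysis.
Set Implicit Arguments.
Unset Strict Implicit.
Unset Printing Implicit Defensive.
Import Order.TTheory GRing.Theory Num.Theory.

Local Open Scope nat_scope.

Record sgraph := SGraph {
  vertex :> finType;
  adj : rel vertex;
  adj_sym : symmetric adj;
  adj_irrefl : irreflexive adj }.

Definition edges (G : sgraph) : {set {set G}} :=
  [set [set uv.1; uv.2] | uv : G * G & adj uv.1 uv.2].

Definition degree (G : sgraph) (v : G) : nat := #|[set u | adj v u]|.

(* A labeling of the vertices by {0, ..., #|G|-1} is an enumeration of G, and  *)
(* a labeling of the neighbors of v by {0, ..., degree v - 1} is an            *)
(* enumeration of the neighborhood of v.                                       *)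
Record labeling (G : sgraph) := Labeling {
  vlabel : seq G;
  nlabel : G -> seq G;
  vlabel_uniq : uniq vlabel;
  mem_vlabel : forall v, v \in vlabel;
  nlabel_uniq : forall v, uniq (nlabel v);
  mem_nlabel : forall u v, (u \in nlabel v) = adj v u }.

(* Algorithms are programs of a randomized word RAM. Its memory consists of    *)
(* cells holding w-bit words, and of separate cells holding vertices. Vertices *)
(* are opaque: they are only obtained from queries, stored, compared, passed   *)
(* to queries and returned.                                                    *)

(* Direct k is the cell k; Indirect k is the cell whose index is the word      *)
(* stored in cell k.                                                           *)
Inductive addr := Direct of nat | Indirect of nat.

Inductive binop := Add | Sub | Mul | Div | Mod | Lt | Eq.

(* The destination is always the first address. *)
Inductive instr :=
| Const of addr & nat
| Op of binop & addr & addr & addr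
| Rand of addr & addr
| VCopy of addr & addr
| VEq of addr & addr & addr
| QVertex of addr & addr
| QDegree of addr & addr
| QNeighbor of addr & addr & addr.

Inductive cmd :=
| Do of instr
| Seq of cmd & cmd
| If of addr & cmd & cmd
| While of addr & cmd.

Definition is_query (i : instr) : bool :=
  match i with
  | QVertex _ _ | QDegree _ _ | QNeighbor _ _ _ => true
  | _ => false
  end.

(* Sub is truncated subtraction; division by 0 gives 0. *)
Definition eval_op (o : binop) (x y : nat) : nat :=
  match o with
  | Add => x + y
  | Sub => x - y
  | Mul => x * y
  | Div => x %/ y
  | Mod => x %% y
  | Lt => x < y
  | Eq => x == y
  end.

(* None is the content of an uninitialized vertex cell. *)
Record state (V : Type) := State {
  words : nat -> nat;
  verts : nat -> option V }.

Definition cell V (s : state V) (a : addr) : nat :=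
  match a with Direct k => k | Indirect k => words s k end.

Definition rdw V (s : state V) (a : addr) : nat := words s (cell s a).
Definition rdv V (s : state V) (a : addr) : option V := verts s (cell s a).

Definition wrw (w : nat) V (s : state V) (a : addr) (x : nat) : state V :=
  State [eta words s with cell s a |-> x %% 2 ^ w] (verts s).
Definition wrv V (s : state V) (a : addr) (v : option V) : state V :=
  State (words s) [eta verts s with cell s a |-> v].

Section Machine.
Variables (w : nat) (G : sgraph) (L : labeling G).

(* The list of the equally likely successor states. Rand d a draws a uniform   *)
(* element of {0, ..., k-1}, with k the word at a (and gives 0 if k = 0).      *)
(* Queries with an invalid argument return None, or 0 for a degree query.      *)
Definition exec (i : instr) (s : state G) : seq (state G) :=
  match i with
  | Const d c => [:: wrw w s d c]
  | Op o d a b => [:: wrw w s d (eval_op o (rdw s a) (rdw s b))]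
  | Rand d a => [seq wrw w s d r | r <- iota 0 (maxn 1 (rdw s a))]
  | VCopy d a => [:: wrv s d (rdv s a)]
  | VEq d a b => [:: wrw w s d (rdv s a == rdv s b)]
  | QVertex d a => [:: wrv s d (onth (vlabel L) (rdw s a))]
  | QDegree d a => [:: wrw w s d (oapp (@degree G) 0 (rdv s a))]
  | QNeighbor d a b =>
      [:: wrv s d (obind (fun v => onth (nlabel L v) (rdw s b)) (rdv s a))]
  end.

(* The stack of the commands still to be executed, and the memory. *)
Definition config : Type := (seq cmd * state G)%type.

Definition halted (c : config) : bool := nilp c.1.

Definition querying (c : config) : bool :=
  if c.1 is Do i :: _ then is_query i else false.

(* The output is the pair of vertices in the vertex cells 0 and 1. *)
Definition output (c : config) : option G * option G :=
  (verts c.2 0, verts c.2 1).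

Definition step (c : config) : seq config :=
  let s := c.2 in
  match c.1 with
  | [::] => [:: c]
  | Do i :: k => [seq (k, s') | s' <- exec i s]
  | Seq p q :: k => [:: (p :: q :: k, s)]
  | If a p q :: k => [:: ((if rdw s a != 0 then p else q) :: k, s)]
  | While a p :: k => [:: (if rdw s a != 0 then p :: While a p :: k else k, s)]
  end.

(* The input n, m is in the word cells 0 and 1. *)
Definition init (p : cmd) (n m : nat) : config :=
  ([:: p], State [eta (fun=> 0) with 0 |-> n %% 2 ^ w, 1 |-> m %% 2 ^ w]
                 (fun=> None)).

Local Open Scope ring_scope.
Variable R : realType.

(* Expected value of f at the configuration reached from c after t steps. *)
Fixpoint expect (t : nat) (f : config -> R) (c : config) : R :=
  if t is t'.+1
  then (\sum_(c' <- step c) expect t' f c') / (size (step c))%:R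
  else f c.

Definition output_by (t : nat) (c : config) (e : G * G) : R :=
  expect t (fun c' => (halted c' && (output c' == (Some e.1, Some e.2)))%:R) c.

Definition expected_time (c : config) : \bar R :=
  (\sum_(0 <= t <oo) (expect t (fun c' => (~~ halted c')%:R) c)%:E)%E.

Definition expected_queries (c : config) : \bar R :=
  (\sum_(0 <= t <oo) (expect t (fun c' => (querying c')%:R) c)%:E)%E.

End Machine.

(* Main.v *)
(* Call a vertex light if its degree is below a threshold T with T^2 >= 8m and  *)
(* T = O(sqrt m). A uniform vertex v and a uniform index below T hit every edge  *)
(* leaving a light vertex with probability 1/(nT). Through the second endpoint,  *)
(* a heavy vertex u is reached with probability d_L(u)/(nT), where d_L(u) is its *)
(* number of light neighbors; accepting it with probability proportional to      *)
(* d(u)/d_L(u) = 1/p and then taking a uniform neighbor gives the edges leaving  *)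
(* heavy vertices the same probability as the others.                            *)
(*                                                                               *)
(* There are at most 2m/T heavy vertices, so p >= 3/4. A coin of bias c/p with   *)
(* c = 1/4 is obtained from samples of neighbors by gambler's ruin: a walk that  *)
(* goes down with bias c and up with bias p reaches 0 from i with probability    *)
(* (c/p)^i. To keep the expected time O(1), the walk is stopped at height        *)
(* k = 2 N^2 at level N, where c_N = (N-1)/(2N); it survives with probability    *)
(* (c_N/c_(N+1))^k <= 1/4 and then goes on with c_(N+1), which is exact because  *)
(* (c_N/p)^k = (c_N/c_(N+1))^k (c_(N+1)/p)^k. At level n, reached with           *)
(* probability at most 4^(2-n), p is computed by reading all neighbors.          *)
(*                                                                               *)
(* Only lower bounds 1/(2m) for the directed edges are needed: they add up to 1. *)

Require Import Defs.
From HB Require Import structures.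
From mathcomp Require Import all_boot all_order all_algebra.
From mathcomp Require Import all_classical all_reals all_analysis.
From mathcomp Require Import zify ring lra.
Set Implicit Arguments.
Unset Strict Implicit.
Unset Printing Implicit Defensive.
Import Order.TTheory GRing.Theory Num.Theory.
Import numFieldNormedType.Exports.
Local Open Scope ring_scope.

(** The sampler is a rejection loop whose attempts return every directed edge with the same
    probability 1/(5nT). An edge (v, y) leaving a light [v] is kept with probability 1/5; otherwise
    a heavy [y] becomes the source with probability 1/(4p) and is followed by a uniform neighbor. As
    p = d_L(y)/d(y), the counts cancel: d_L(y) * 4/5 * 1/(4p) * 1/d(y) = 1/5 ([sum_light_edges],
    [sum_gain]). An attempt succeeds with probability 2m/(5nT) and costs O(1) on average, so T of
    order sqrt m gives O(n / sqrt m) ([runs_attempt], [threshold_bounds]). The walk realizes the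
    bias 1/(4p) although p is unknown ([runs_walk]).

    The program is verified with a Hoare-style judgement [runs t k ws vs h V]: at horizon [t], the
    probability of having output [e] or of being unfinished is at least [h], and the expected time
    spent is at most [V]. Loops are closed by induction on [t], since 1/(2m) is a fixed point of an
    attempt. The bounded expected time sends the probability [D t] of still running to 0, and the 2m
    lower bounds 1/(2m) - [D t], whose events are disjoint, squeeze each output probability to its
    limit ([output_by_ge], [output_by_le]). *)

(** * Expectations and running time up to a finite horizon *)

Section Expectation.
Variables (R : realType) (w : nat) (G : sgraph) (L : labeling G).
Implicit Types (c : config G) (s : state G) (k : seq cmd).

Definition mean (T : Type) (s : seq T) (f : T -> R) : R :=
  (\sum_(x <- s) f x) / (size s)%:R.

Lemma ler_mean (T : Type) (s : seq T) (f g : T -> R) :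
  (forall x, f x <= g x) -> mean s f <= mean s g.
Proof.
by move=> fg; rewrite /mean ler_wpM2r ?invr_ge0//; apply: ler_sum => x _.
Qed.

Lemma ler_mean_in (T : eqType) (s : seq T) (f g : T -> R) :
  {in s, forall x, f x <= g x} -> mean s f <= mean s g.
Proof.
move=> fg; rewrite /mean ler_wpM2r ?invr_ge0// big_seq [leRHS]big_seq.
exact: ler_sum.
Qed.

Lemma mean_map (S T : Type) (F : S -> T) (s : seq S) (f : T -> R) :
  mean (map F s) f = mean s (f \o F).
Proof. by rewrite /mean big_map size_map. Qed.

Lemma mean_const (T : Type) (s : seq T) (a : R) :
  (0 < size s)%N -> mean s (fun=> a) = a.
Proof.
move=> s0; rewrite /mean big_const_seq count_predT iter_addr_0.
by rewrite -[a *+ _]mulr_natr mulfK// pnatr_eq0 -lt0n.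
Qed.

Lemma meanD (T : Type) (s : seq T) (f g : T -> R) :
  mean s (fun x => f x + g x) = mean s f + mean s g.
Proof. by rewrite /mean big_split mulrDl. Qed.

Lemma expectS t f c :
  expect w L t.+1 f c = mean (step w L c) (expect w L t f) :> R.
Proof. by []. Qed.

Lemma size_step c : (0 < size (step w L c))%N.
Proof.
case: c => -[|[i|p q|a p q|a p] k] s //=; rewrite size_map.
by case: i => //= *; rewrite size_map size_iota leq_max.
Qed.

Lemma ler_expect t (f g : config G -> R) c :
  (forall c, f c <= g c) -> expect w L t f c <= expect w L t g c.
Proof.
by move=> fg; elim: t c => [|t IH] c //=; exact: ler_mean.
Qed.

Lemma expect_const t (a : R) c : expect w L t (fun=> a) c = a.
Proof.
elim: t c => [|t IH] c //=; under eq_bigr do rewrite IH.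
exact/mean_const/size_step.
Qed.

Lemma expectD t (f g : config G -> R) c :
  expect w L t (fun c => f c + g c) c = expect w L t f c + expect w L t g c.
Proof.
elim: t c => [|t IH] c //=; under eq_bigr do rewrite IH.
exact: meanD.
Qed.

Lemma expect_sum (I : Type) (r : seq I) (P : pred I) t
    (f : I -> config G -> R) c :
  expect w L t (fun c => \sum_(i <- r | P i) f i c) c =
  \sum_(i <- r | P i) expect w L t (f i) c.
Proof.
elim: t c => [|t IH] c //=; under eq_bigr do rewrite IH.
by rewrite exchange_big mulr_suml.
Qed.

Definition running c : R := (~~ halted c)%:R.

Fixpoint time_before (t : nat) c : R :=
  if t is t'.+1 then running c + mean (step w L c) (time_before t') else 0.

Lemma time_beforeE t c :
  time_before t c = \sum_(0 <= i < t) expect w L i running c.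
Proof.
elim: t c => [|t IH] c; first by rewrite big_geq.
rewrite big_nat_recl//; congr (_ + _).
under [RHS]eq_bigr do rewrite expectS.
rewrite /mean -mulr_suml exchange_big; congr (_ / _).
by apply: eq_bigr => c' _; exact: IH.
Qed.

Lemma time_before_ge0 t c : 0 <= time_before t c.
Proof.
rewrite time_beforeE; apply: sumr_ge0 => i _.
by rewrite -(expect_const i 0 c); apply: ler_expect => c'; rewrite ler0n.
Qed.

Lemma time_beforeS t c : time_before t c <= time_before t.+1 c.
Proof.
rewrite !time_beforeE big_nat_recr//= lerDl.
by rewrite -(expect_const t 0 c); apply: ler_expect => c'; rewrite ler0n.
Qed.

Variable e : G * G.

Definition outputs c : R := (halted c && (output c == (Some e.1, Some e.2)))%:R.
(* Its expectation decreases to the probability of outputting e, so a lower    *)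
(* bound that holds at every time t passes to the limit.                       *)
Definition viable c : R := outputs c + running c.

Lemma viable_le1 c : viable c <= 1.
Proof.
rewrite /viable /outputs /running; case: halted => /=; rewrite ?add0r// addr0.
by rewrite lern1 leq_b1.
Qed.

Lemma expect_viable_le1 t c : expect w L t viable c <= 1.
Proof. by rewrite -(expect_const t 1 c); apply/ler_expect/viable_le1. Qed.

Lemma expect_viableS t c :
  expect w L t.+1 viable c <= expect w L t viable c.
Proof.
elim: t c => [|t IH] c; last by rewrite expectS [leRHS]expectS; exact: ler_mean.
rewrite expectS /=.
have [hc|hc] := boolP (halted c).
  by case: c hc => -[]//= s _; rewrite /mean big_seq1 divr1.
rewrite [leRHS]/viable /running hc [leRHS]addrC.
apply: (@le_trans _ _ 1); last by rewrite lerDl ler0n.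
by rewrite -(mean_const 1 (size_step c)); apply/ler_mean/viable_le1.
Qed.

(** The horizon is finite so that possibly endless loops can be treated by induction on it; an
    unfinished run counts fully towards [h]. *)
Definition ensures t c h V : Prop :=
  h <= expect w L t viable c /\ time_before t c <= V.

Lemma ensures_weaken t c h V h' V' :
  ensures t c h V -> h' <= h -> V <= V' -> ensures t c h' V'.
Proof. by move=> [H1 H2] H3 H4; split; [exact: le_trans H1|exact: le_trans H2 _]. Qed.

Lemma ensuresW t c h V : ensures t.+1 c h V -> ensures t c h V.
Proof.
move=> [h1 h2]; split; first exact: le_trans h1 (expect_viableS _ _).
exact: le_trans (time_beforeS _ _) h2.
Qed.

Lemma ensures_le t t' c h V : (t <= t')%N -> ensures t' c h V -> ensures t c h V.
Proof.
by move=> /subnK <-; elim: (_ - _)%N => // n IH; rewrite addSn => /ensuresW.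
Qed.

Lemma ensures_branch (T : eqType) t c (r : seq T) (F : T -> config G)
    (h V : T -> R) :
  ~~ halted c -> step w L c = map F r ->
  {in r, forall x, ensures t (F x) (h x) (V x)} ->
  ensures t c (mean r h) (mean r V + 1).
Proof.
move=> hc E H; have r0 : (0 < size r)%N.
  by rewrite -(size_map F) -E size_step.
case: t H => [|t] H.
  have [h1 V0] : mean r h <= 1 /\ 0 <= mean r V.
    split; [rewrite -[leRHS](mean_const _ r0)|rewrite -[leLHS](mean_const _ r0)].
      apply: ler_mean_in => x /H[h1 _]; apply: le_trans h1 _.
      exact: expect_viable_le1.
    by apply: ler_mean_in => x /H[].
  split; last by rewrite addr_ge0.
  by rewrite /= /viable /running hc (le_trans h1)// lerDr ler0n.
split; first by rewrite expectS E mean_map; apply: ler_mean_in => x /H/ensuresW[].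
rewrite [leLHS]/= /running hc E mean_map addrC lerD2r.
by apply: ler_mean_in => x /H/ensuresW[].
Qed.

Lemma ensures_det t c c' h V : ~~ halted c -> step w L c = [:: c'] ->
  ensures t c' h V -> ensures t c h (V + 1).
Proof.
move=> hc E H.
have := @ensures_branch unit t c [:: tt] (fun=> c') (fun=> h) (fun=> V) hc E.
by rewrite !mean_const//; apply.
Qed.

(** The horizon strictly decreases here, which is what makes the induction for loops work; at
    horizon 0 a running configuration satisfies any [h <= 1]. *)
Lemma ensures_later t c c' h V : ~~ halted c -> step w L c = [:: c'] ->
  h <= 1 -> 1 <= V -> (forall t', t = t'.+1 -> ensures t' c' h (V - 1)) ->
  ensures t c h V.
Proof.
move=> hc E h1 V1 H; case: t H => [|t] H.
  split=> /=; last exact: le_trans V1.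
  by rewrite /viable /running hc (le_trans h1)// lerDr ler0n.
have [H1 H2] := H t erefl; split; first by rewrite expectS E /mean big_seq1 divr1.
by rewrite [leLHS]/= /running hc E /mean big_seq1 divr1 -lerBrDl.
Qed.

End Expectation.


(** * Proof rules for the instructions *)

Section Rules.
Variables (R : realType) (w : nat) (G : sgraph) (L : labeling G) (e : G * G).
Implicit Types (k : seq cmd) (ws : seq nat) (vs : seq (option G)) (h V : R).

(* The machine memory is tracked only on the initial segments listed in ws, vs. *)
Definition rep (s : state G) ws vs : Prop :=
  (forall i, (i < size ws)%N -> words s i = nth 0%N ws i) /\
  (forall i, (i < size vs)%N -> verts s i = nth None vs i).

Definition runs t k ws vs h V : Prop :=
  forall s, rep s ws vs -> ensures w L e t (k, s) h V.

Lemma runs_weaken t k ws vs h V h' V' :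
  runs t k ws vs h V -> h' <= h -> V <= V' -> runs t k ws vs h' V'.
Proof. by move=> H H1 H2 s /H H3; exact: ensures_weaken H3 H1 H2. Qed.

Lemma runs_le t t' k ws vs h V :
  (t <= t')%N -> runs t' k ws vs h V -> runs t k ws vs h V.
Proof. by move=> tt' H s /H; exact: ensures_le. Qed.

Lemma rep_wrw s ws vs d x : rep s ws vs -> (d < size ws)%N -> (x < 2 ^ w)%N ->
  rep (wrw w s (Direct d) x) (set_nth 0%N ws d x) vs.
Proof.
move=> [sw sv] dw xw; split=> //= i; rewrite size_set_nth (maxn_idPr dw) => iw.
by rewrite nth_set_nth /= modn_small//; case: eqP => // _; exact: sw.
Qed.

Lemma rep_wrv s ws vs d x : rep s ws vs -> (d < size vs)%N ->
  rep (wrv s (Direct d) x) ws (set_nth None vs d x).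
Proof.
move=> [sw sv] dw; split=> //= i; rewrite size_set_nth (maxn_idPr dw) => iw.
by rewrite nth_set_nth /=; case: eqP => // _; exact: sv.
Qed.

Lemma ensures_det_sub t (c c' : config G) h V : ~~ halted c ->
  step w L c = [:: c'] -> ensures w L e t c' h (V - 1) -> ensures w L e t c h V.
Proof. by move=> hc E /(ensures_det hc E); rewrite subrK. Qed.

Lemma runs_const t k ws vs d c h V : (d < size ws)%N -> (c < 2 ^ w)%N ->
  runs t k (set_nth 0%N ws d c) vs h (V - 1) ->
  runs t (Do (Const (Direct d) c) :: k) ws vs h V.
Proof.
move=> dw cw H s sr; apply: ensures_det_sub => //.
exact/H/rep_wrw.
Qed.

Lemma runs_op t k ws vs o d a b h V :
  (d < size ws)%N -> (a < size ws)%N -> (b < size ws)%N ->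
  (eval_op o (nth 0 ws a) (nth 0 ws b) < 2 ^ w)%N ->
  runs t k (set_nth 0%N ws d (eval_op o (nth 0 ws a) (nth 0 ws b))%N) vs h (V - 1) ->
  runs t (Do (Op o (Direct d) (Direct a) (Direct b)) :: k) ws vs h V.
Proof.
move=> dw aw bw cw H s sr; apply: ensures_det_sub => //.
by rewrite /rdw /= !sr.1//; apply/H/rep_wrw.
Qed.

Lemma runs_rand t k ws vs d a (h' V' : nat -> R) h V :
  (d < size ws)%N -> (a < size ws)%N -> (0 < nth 0 ws a <= 2 ^ w)%N ->
  (forall r, (r < nth 0 ws a)%N ->
    runs t k (set_nth 0%N ws d r) vs (h' r) (V' r)) ->
  h <= mean (iota 0 (nth 0%N ws a)) h' ->
  mean (iota 0 (nth 0%N ws a)) V' + 1 <= V ->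
  runs t (Do (Rand (Direct d) (Direct a)) :: k) ws vs h V.
Proof.
move=> dw aw /andP[n0 nw] H hh VV s sr; apply: ensures_weaken hh VV.
apply: (@ensures_branch R w G L e _ t _ _ (fun r => (k, wrw w s (Direct d) r))) => //.
  rewrite -[nth 0%N ws a](maxn_idPr n0) -[X in maxn _ X]sr.1//.
  by rewrite [RHS](map_comp (pair k) (wrw w s (Direct d))).
move=> r; rewrite mem_iota add0n => /andP[_ rn]; apply: (H r rn).
apply: rep_wrw => //; exact: leq_trans rn nw.
Qed.

Lemma runs_vcopy t k ws vs d a h V : (d < size vs)%N -> (a < size vs)%N ->
  runs t k ws (set_nth None vs d (nth None vs a)) h (V - 1) ->
  runs t (Do (VCopy (Direct d) (Direct a)) :: k) ws vs h V.
Proof.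
move=> dw aw H s sr; apply: ensures_det_sub => //.
by rewrite /rdv /= sr.2//; apply/H/rep_wrv.
Qed.

Lemma runs_qvertex t k ws vs d a h V : (d < size vs)%N -> (a < size ws)%N ->
  runs t k ws (set_nth None vs d (onth (vlabel L) (nth 0%N ws a))) h (V - 1) ->
  runs t (Do (QVertex (Direct d) (Direct a)) :: k) ws vs h V.
Proof.
move=> dw aw H s sr; apply: ensures_det_sub => //.
by rewrite /rdw /= sr.1//; apply/H/rep_wrv.
Qed.

Lemma runs_qdegree t k ws vs d a v h V : (d < size ws)%N -> (a < size vs)%N ->
  nth None vs a = Some v -> (degree v < 2 ^ w)%N ->
  runs t k (set_nth 0%N ws d (degree v)) vs h (V - 1) ->
  runs t (Do (QDegree (Direct d) (Direct a)) :: k) ws vs h V.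
Proof.
move=> dw aw E vw H s sr; apply: ensures_det_sub => //.
by rewrite /rdv /= sr.2// E; apply/H/rep_wrw.
Qed.

Lemma runs_qneighbor t k ws vs d a b v h V :
  (d < size vs)%N -> (a < size vs)%N -> (b < size ws)%N ->
  nth None vs a = Some v ->
  runs t k ws (set_nth None vs d (onth (nlabel L v) (nth 0%N ws b))) h (V - 1) ->
  runs t (Do (QNeighbor (Direct d) (Direct a) (Direct b)) :: k) ws vs h V.
Proof.
move=> dw aw bw E H s sr; apply: ensures_det_sub => //.
by rewrite /rdv /rdw /= sr.2// sr.1// E; apply/H/rep_wrv.
Qed.

Lemma runs_seq t p q k ws vs h V :
  runs t (p :: q :: k) ws vs h (V - 1) -> runs t (Seq p q :: k) ws vs h V.
Proof. by move=> H s /H; exact: ensures_det_sub. Qed.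

Lemma runs_if t a p q k ws vs h V : (a < size ws)%N ->
  runs t ((if nth 0%N ws a != 0%N then p else q) :: k) ws vs h (V - 1) ->
  runs t (If (Direct a) p q :: k) ws vs h V.
Proof.
move=> aw H s sr.
apply: (@ensures_det_sub t _
  ((if nth 0%N ws a != 0%N then p else q) :: k, s)) => //.
  by rewrite /step /rdw /= sr.1.
exact: H.
Qed.

Lemma runs_exit t a p k ws vs h V : (a < size ws)%N -> nth 0%N ws a = 0%N ->
  runs t k ws vs h (V - 1) -> runs t (While (Direct a) p :: k) ws vs h V.
Proof.
move=> aw a0 H s sr; apply: (@ensures_det_sub t _ (k, s)) => //.
  by rewrite /step /rdw /= sr.1// a0.
exact: H.
Qed.

Lemma runs_unroll t a p k ws vs h V : (a < size ws)%N -> nth 0%N ws a != 0%N ->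
  runs t (p :: While (Direct a) p :: k) ws vs h (V - 1) ->
  runs t (While (Direct a) p :: k) ws vs h V.
Proof.
move=> aw a0 H s sr.
apply: (@ensures_det_sub t _ (p :: While (Direct a) p :: k, s)) => //.
  by rewrite /step /rdw /= sr.1// a0.
exact: H.
Qed.

Lemma runs_loop t a p k ws vs h V : (a < size ws)%N -> nth 0%N ws a != 0%N ->
  h <= 1 -> 1 <= V ->
  (forall t', t = t'.+1 ->
    runs t' (p :: While (Direct a) p :: k) ws vs h (V - 1)) ->
  runs t (While (Direct a) p :: k) ws vs h V.
Proof.
move=> aw a0 h1 V1 H s sr.
apply: (@ensures_later _ _ _ _ _ t _ (p :: While (Direct a) p :: k, s)) => //.
  by rewrite /step /rdw /= sr.1// a0.
by move=> t' E; apply: H.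
Qed.

End Rules.


(** * Uniform draws and the coin-tossing loop *)

Section Means.
Variable R : realType.

Lemma mean_ltn (A B : nat) (x y : R) : (A <= B)%N -> (0 < B)%N ->
  mean (iota 0 B) (fun r => if (r < A)%N then x else y) =
  y + (x - y) * (A%:R / B%:R).
Proof.
move=> AB B0; have B0' : B%:R != 0 :> R by rewrite pnatr_eq0 -lt0n.
rewrite /mean size_iota -{1}(subnKC AB) iotaD big_cat add0n /=.
rewrite (eq_big_seq (fun=> x)); last first.
  by move=> r; rewrite mem_iota /= add0n => ->.
rewrite [X in _ + X](eq_big_seq (fun=> y)); last first.
  by move=> r; rewrite mem_iota => /andP[Ar _]; rewrite ltnNge Ar.
rewrite !big_const_seq !count_predT !size_iota !iter_addr_0.
rewrite -[x *+ A]mulr_natr -[y *+ _]mulr_natr natrB//.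
by field.
Qed.

Lemma runs_le1 w (G : sgraph) (L : labeling G) e t k ws vs (h V : R) :
  runs w L e t k ws vs h V -> h <= 1.
Proof.
move=> /(_ (State (nth 0%N ws) (nth None vs))) [//|H _].
apply: le_trans H _; exact: expect_viable_le1.
Qed.

Lemma runs_ge0 w (G : sgraph) (L : labeling G) e t k ws vs (h V : R) :
  runs w L e t k ws vs h V -> 0 <= V.
Proof.
move=> /(_ (State (nth 0%N ws) (nth None vs))) [//|_ H].
apply: le_trans H; exact: time_before_ge0.
Qed.

End Means.

Infix ";;" := Seq (at level 60, right associativity).
Notation "d ::= c" := (Do (Const (Direct d) c)) (at level 50).
Notation "d ::= a +' b" := (Do (Op Defs.Add (Direct d) (Direct a) (Direct b))) (at level 50).
Notation "d ::= a -' b" := (Do (Op Defs.Sub (Direct d) (Direct a) (Direct b))) (at level 50).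
Notation "d ::= a *' b" := (Do (Op Defs.Mul (Direct d) (Direct a) (Direct b))) (at level 50).
Notation "d ::= a /' b" := (Do (Op Defs.Div (Direct d) (Direct a) (Direct b))) (at level 50).
Notation "d ::= a <' b" := (Do (Op Defs.Lt (Direct d) (Direct a) (Direct b))) (at level 50).
Notation "d ::= 'random' a" := (Do (Rand (Direct d) (Direct a))) (at level 50).

(* Tosses k coins of bias A/B; a failure resets k, i and the verdict to 0. *)
Definition flips : cmd :=
  While (Direct 10) (
    5 ::= random 15 ;; 5 ::= 5 <' 14 ;;
    10 ::= 10 -' 12 ;; 10 ::= 10 *' 5 ;; 7 ::= 7 *' 5 ;; 11 ::= 11 *' 5).

(* Word cells: 0 n, 1 m, 2 b, 3 T, 4 the degree of the vertex in vertex cell 0, *)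
(* 5 and 6 scratch, 7 the position i of the walk, 8 its level N, 9 the flag of   *)
(* the current outer loop, 10 the barrier of the level (or the number of coins   *)
(* still to be flipped), 11 the verdict of the walk, 12 and 13 the constants 1   *)
(* and 2, 14 and 15 the bias A/B of a coin, 16 a light degree, 17 a counter,     *)
(* 18 scratch flag.                                                              *)
Definition memory (n m b T d r x i N run k acc A B dL c f : nat) : seq nat :=
  [:: n; m; b; T; d; r; x; i; N; run; k; acc; 1%N; 2%N; A; B; dL; c; f].

Ltac le_eq := rewrite le_eqVlt; apply/orP; left; apply/eqP.
Ltac step_seq := apply: runs_seq.
Ltac step_op :=
  apply: runs_op; [by []|by []|by []|rewrite /=|rewrite [set_nth _ _ _ _]/=].

Section Prog.
Variables (R : realType) (w : nat) (G : sgraph) (L : labeling G) (e : G * G).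
Notation runs := (@runs R w G L e).
Hypothesis w0 : (1 < 2 ^ w)%N.

Lemma ltn_w (b : bool) : (b < 2 ^ w)%N.
Proof. by case: b => //; apply: ltn_trans w0. Qed.

Lemma runs_flips t ks n m b T d x i N run acc A B dL c f vs h0 h1 V0 V1 :
  (A <= B)%N -> (0 < B <= 2 ^ w)%N -> (i < 2 ^ w)%N -> (acc < 2 ^ w)%N ->
  (forall r, runs t ks (memory n m b T d r x i N run 0 acc A B dL c f) vs h1 V1) ->
  (forall r, runs t ks (memory n m b T d r x 0 N run 0 0 A B dL c f) vs h0 V0) ->
  let q : R := A%:R / B%:R in
  forall k, (k < 2 ^ w)%N -> forall r,
  runs t (flips :: ks) (memory n m b T d r x i N run k acc A B dL c f) vs
    (h0 + (h1 - h0) * q ^+ k) (V0 + (V1 - V0) * q ^+ k + 12 * k%:R + 1).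
Proof.
move=> AB Bw iw aw + + q.
have B0 : (0 < B)%N by case/andP: Bw.
have q01 : 0 <= q <= 1.
  by rewrite /q divr_ge0//= ler_pdivrMr ?ltr0n// mul1r ler_nat.
move=> H1 H0.
elim=> [|k IH] kw r.
  by apply: runs_exit => //; apply: runs_weaken (H1 r) _ _; rewrite expr0; lra.
apply: runs_unroll => //.
step_seq; apply: (@runs_rand _ _ _ _ _ _ _ _ _ _ _
  (fun r => if (r < A)%N then h0 + (h1 - h0) * q ^+ k else h0)
  (fun r => if (r < A)%N then V0 + (V1 - V0) * q ^+ k + 12 * k%:R + 10 else V0 + 10)) => //.
- move=> r' rB; rewrite [set_nth _ _ _ _]/=.
  step_seq; step_op; first exact: ltn_w.
  step_seq; step_op; first lia.
  step_seq; step_op; first by case: ltnP; lia.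
  step_seq; step_op; first by case: ltnP; lia.
  step_op; first by case: ltnP; lia.
  case: ltnP => _; rewrite ?muln1 ?muln0 ?subSS ?subn0.
    by apply: runs_weaken (IH _ _) _ _; [exact: ltnW|lra|lra].
  by apply: runs_exit => //; apply: runs_weaken (H0 _) _ _; lra.
- by rewrite [nth _ _ _]/= mean_ltn// exprS -/q; le_eq; ring.
- rewrite [nth _ _ _]/= mean_ltn// exprS -/q -[k.+1%:R]natr1.
  have := ler0n R k; case/andP: q01 => q0 q1 k0.
  (* A failure skips the remaining [k] coins; this is the slack in the time bound. *)
  have : 0 <= (1 - q) * k%:R by rewrite mulr_ge0// subr_ge0.
  clear -q0 q1 k0; clearbody q; move: (q ^+ k) => X kq; nra.
Qed.
End Prog.


Notation "d ::= 'neighbor' a b" :=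
  (Do (QNeighbor (Direct d) (Direct a) (Direct b))) (at level 50, a at level 0, b at level 0).
Notation "d ::= 'degree' a" := (Do (QDegree (Direct d) (Direct a))) (at level 50).

(** * Light neighbors, and sums along the labelings *)

Section Graph.
Variables (R : realType) (G : sgraph) (L : labeling G).

Definition light_degree (T : nat) (u : G) : nat :=
  #|[set y | adj u y & (degree y < T)%N]|.

Lemma big_uniq_seq (s : seq G) (P : pred G) (f : G -> R) :
  uniq s -> s =i P -> \sum_(y <- s) f y = \sum_(y | P y) f y.
Proof.
by move=> su sP; rewrite big_uniq//; apply: eq_bigl => y; rewrite sP.
Qed.

Lemma size_uniq_card (s : seq G) (P : pred G) :
  uniq s -> s =i P -> size s = #|[set y | P y]|.
Proof.
move=> /card_uniqP <- sP; apply: eq_card => y.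
by rewrite sP inE.
Qed.

Lemma size_nlabel u : size (nlabel L u) = degree u.
Proof. by apply: size_uniq_card; [exact: nlabel_uniq|move=> y; exact: mem_nlabel]. Qed.

Lemma size_vlabel : size (vlabel L) = #|G|.
Proof.
rewrite (@size_uniq_card _ xpredT) ?cardsT ?vlabel_uniq// => y.
by rewrite mem_vlabel.
Qed.

Lemma count_nlabel T u :
  count (fun y => (degree y < T)%N) (nlabel L u) = light_degree T u.
Proof.
rewrite -size_filter.
apply: size_uniq_card => [|y]; first by rewrite filter_uniq ?nlabel_uniq.
by rewrite mem_filter mem_nlabel andbC.
Qed.

Lemma sum_light T u (x y : R) :
  \sum_(v | adj u v) (if (degree v < T)%N then x else y) =
  y * (degree u)%:R + (x - y) * (light_degree T u)%:R.
Proof.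
rewrite (eq_bigr (fun v => y + (if (degree v < T)%N then x - y else 0))); last first.
  by move=> v _; case: ifP => _; ring.
rewrite big_split -big_mkcondr /= !sumr_const !mulr_natr.
by congr (_ *+ _ + _ *+ _); apply: eq_card => v; rewrite !inE.
Qed.

Lemma sum_adj_const (u : G) (x : R) : \sum_(v | adj u v) x = x * (degree u)%:R.
Proof.
rewrite sumr_const mulr_natr; congr (_ *+ _).
by apply: eq_card => v; rewrite inE.
Qed.

Lemma light_degree_le T u : (light_degree T u <= degree u)%N.
Proof. by apply/subset_leq_card/fintype.subsetP => y; rewrite !inE => /andP[]. Qed.

Lemma onth_lt (s : seq G) x0 r : (r < size s)%N -> onth s r = Some (nth x0 s r).
Proof. by move=> rs; rewrite onthE (nth_map x0). Qed.

Lemma sum_onth (s : seq G) (f : option G -> R) :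
  \sum_(r <- iota 0 (size s)) f (onth s r) = \sum_(y <- s) f (Some y).
Proof.
case: s => [|x0 s]; first by rewrite !big_nil.
rewrite [RHS](big_nth x0) /index_iota subn0; apply: eq_big_seq => r.
by rewrite mem_iota => /andP[_ rs]; rewrite (onth_lt x0).
Qed.

End Graph.

(** * Sampling a neighbor and counting the light neighbors *)

Section Prog.
Variables (R : realType) (w : nat) (G : sgraph) (L : labeling G) (e : G * G).
Notation runs := (@runs R w G L e).
Hypothesis w0 : (1 < 2 ^ w)%N.

Lemma runs_rand_neighbor t p k ws vs c a d b u (h' V' : G -> R) h V :
  (c < size ws)%N -> (a < size ws)%N -> (d < size vs)%N -> (b < size vs)%N ->
  nth 0%N ws a = degree u -> nth None vs b = Some u ->
  (0 < degree u <= 2 ^ w)%N ->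
  (forall r y, adj u y -> runs t (p :: k) (set_nth 0%N ws c r)
     (set_nth None vs d (Some y)) (h' y) (V' y)) ->
  h <= (\sum_(y | adj u y) h' y) / (degree u)%:R ->
  (\sum_(y | adj u y) V' y) / (degree u)%:R + 3 <= V ->
  runs t ((c ::= random a) :: (d ::= neighbor b c ;; p) :: k) ws vs h V.
Proof.
move=> cw aw dv bv wa vb u0 H hh VV.
apply: (@runs_rand _ _ _ _ _ _ _ _ _ _ _ 
  (fun r => odflt 0 (omap h' (onth (nlabel L u) r)))
  (fun r => odflt 0 (omap V' (onth (nlabel L u) r)) + 2)) => //; rewrite wa//.
- move=> r ru; step_seq.
  apply: (@runs_qneighbor _ _ _ _ _ _ _ _ _ _ _ _ u) => //.
    by rewrite size_set_nth; apply: leq_trans (leq_maxl _ _).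
  rewrite nth_set_nth /= eqxx.
  have rs : (r < size (nlabel L u))%N by rewrite size_nlabel.
  case E : (onth (nlabel L u) r) => [y|] /=.
    apply: runs_weaken (H r y _) _ _; [|by []|lra].
    by rewrite -(mem_nlabel L); apply/onthP; exists r.
  by move: rs; rewrite -onthTE E.
- rewrite -(size_nlabel L) /mean size_iota (sum_onth _ (fun o => odflt 0 (omap h' o))).
  apply: le_trans hh _; rewrite size_nlabel ler_wpM2r ?invr_ge0//.
  by rewrite (big_uniq_seq (P := adj u)) ?nlabel_uniq// => y; exact: mem_nlabel.
- rewrite -(size_nlabel L) meanD {1}/mean size_iota (sum_onth _ (fun o => odflt 0 (omap V' o))).
  rewrite mean_const ?size_iota ?size_nlabel; last by case/andP: u0.
  rewrite (big_uniq_seq (P := adj u)) ?nlabel_uniq//; last by move=> y; exact: mem_nlabel.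
  by apply: le_trans VV; rewrite /=; lra.
Qed.

Definition count_light : cmd :=
  16 ::= 0 ;; 17 ::= 4 +' 16 ;;
  While (Direct 17) (
    17 ::= 17 -' 12 ;; 2 ::= neighbor 0 17 ;; 6 ::= degree 2 ;;
    6 ::= 6 <' 3 ;; 16 ::= 16 +' 6).

Lemma runs_count_light t ks n m b T r x i N run k acc A B dL c f v1 v2 u h V :
  (forall v : G, (degree v < 2 ^ w)%N) ->
  (forall x v2, runs t ks (memory n m b T (degree u) r x i N run k acc A B
     (light_degree T u) 0 f) [:: Some u; v1; v2] h V) ->
  runs t (count_light :: ks)
    (memory n m b T (degree u) r x i N run k acc A B dL c f) [:: Some u; v1; v2]
    h (V + 10 * (degree u)%:R + 5).
Proof.
move=> dw H; rewrite /count_light.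
step_seq; apply: runs_const => //; first exact: ltn_w false.
step_seq; step_op; first by rewrite addn0.
rewrite addn0.
set P := fun y : G => (degree y < T)%N; set s := nlabel L u.
set body := (X in While _ X).
(* The counter runs downwards, so at value [j] the neighbors with labels at least [j] have been
   counted. *)
have loop j x' v2' : (j <= degree u)%N ->
    runs t (While (Direct 17) body :: ks)
      (memory n m b T (degree u) r x' i N run k acc A B (count P (drop j s)) j f)
      [:: Some u; v1; v2'] h (V + 10 * j%:R + 1).
  elim: j x' v2' => [|j IH] x' v2' ju.
    rewrite drop0 count_nlabel; apply: runs_exit => //.
    by apply: runs_weaken (H _ _) _ _; lra.
  apply: runs_unroll => //; rewrite {1}/body.
  have js : (j < size s)%N by rewrite size_nlabel.
  step_seq; step_op; first by have := dw u; lia.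
  rewrite subSS subn0; step_seq.
  apply: (@runs_qneighbor _ _ _ _ _ _ _ _ _ _ _ _ u) => //.
  rewrite [onth _ _]/= (onth_lt u js) [set_nth _ _ _ _]/=.
  step_seq; apply: runs_qdegree => //; rewrite [set_nth _ _ _ _]/=.
  step_seq; step_op; first exact: ltn_w.
  have cE : (count P (drop j.+1 s) + P (nth u s j))%N = count P (drop j s).
    by rewrite (drop_nth u js) /= addnC.
  step_op; rewrite -/s -[(degree _ < T)%N]/(P _) cE.
    apply: leq_ltn_trans (dw u); rewrite -(size_nlabel L).
    by apply: leq_trans (count_size _ _) _; rewrite size_drop leq_subr.
  by apply: runs_weaken (IH _ _ (ltnW ju)) _ _; rewrite -?natr1; lra.
have := loop (degree u) x v2 (leqnn _).
rewrite drop_oversize ?size_nlabel//= => H'.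
by apply: runs_weaken H' _ _; lra.
Qed.

End Prog.


(** * The walk: program and constants *)

(** A fair coin chooses between a downward trial of bias [tilt N] and an upward trial, which
    succeeds if a random neighbor is light. The bias p is thus used without being computed, and both
    rates are halved. *)
Definition walk_step : cmd :=
  5 ::= random 13 ;;
  If (Direct 5)
    (6 ::= 13 *' 8 ;; 5 ::= 8 -' 12 ;; 6 ::= random 6 ;; 6 ::= 6 <' 5 ;;
     7 ::= 7 -' 6)
    (5 ::= random 4 ;; 2 ::= neighbor 0 5 ;; 6 ::= degree 2 ;; 6 ::= 6 <' 3 ;;
     7 ::= 7 +' 6).

(** The coin has bias [tilt N / tilt N.+1] below level n, and [tilt n / p] at level n, where the
    light neighbors are counted. *)
Definition level_coin : cmd :=
  18 ::= 8 <' 0 ;;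
  If (Direct 18)
    (14 ::= 8 -' 12 ;; 15 ::= 8 +' 12 ;; 14 ::= 14 *' 15 ;; 15 ::= 8 *' 8)
    (count_light ;; 14 ::= 8 -' 12 ;; 14 ::= 14 *' 4 ;; 15 ::= 8 *' 13 ;;
     15 ::= 15 *' 16).

Definition next_level : cmd :=
  If (Direct 18) (8 ::= 8 +' 12 ;; 10 ::= 8 *' 8 ;; 10 ::= 10 *' 13) (7 ::= 0).

Definition walk : cmd :=
  While (Direct 7)
    (5 ::= 7 <' 10 ;; If (Direct 5) walk_step (level_coin ;; flips ;; next_level)).

Section Constants.
Variable R : realType.

(* Level N of the walk steps down with bias tilt N, which increases from 1/4   *)
(* to 1/2; passing to level N+1 costs a factor tilt N / tilt (N+1) per unit of *)
(* height.                                                                      *)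
Definition tilt (N : nat) : R := (N%:R - 1) / (2 * N%:R).

Definition light_fraction (G : sgraph) (T : nat) (u : G) : R :=
  (light_degree T u)%:R / (degree u)%:R.

Lemma tilt_bounds N : (2 <= N)%N -> 0 <= tilt N <= 1 / 2.
Proof.
move=> N2; have N0 : 2 <= N%:R :> R by rewrite ler_nat.
by rewrite /tilt ler_pdivrMr ?ler_pdivlMr; lra.
Qed.

Lemma bernoulli_ineq (x : R) k : 0 <= x -> 1 + x * k%:R <= (1 + x) ^+ k.
Proof.
move=> x0; elim: k => [|k IH]; first by rewrite expr0 mulr0 addr0.
rewrite exprS -natr1; apply: le_trans (_ : (1 + x) * (1 + x * k%:R) <= _).
  have : 0 <= x * (x * k%:R) by rewrite !mulr_ge0.
  lra.
by rewrite ler_wpM2l// addr_ge0.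
Qed.

(** The quotient [tilt N / tilt N.+1], in the form of the integer fraction held by the machine. *)
Definition level_ratio (N : nat) : R := ((N - 1) * (N + 1))%:R / (N * N)%:R.

Lemma level_ratio_bounds N : (2 <= N)%N -> 0 <= level_ratio N <= 1.
Proof.
move=> N2; have K0 : (0 < N * N)%N by nia.
by rewrite /level_ratio divr_ge0//= ler_pdivrMr ?ltr0n// mul1r ler_nat; nia.
Qed.

Lemma tilt_level_ratio N : (2 <= N)%N -> tilt N = tilt N.+1 * level_ratio N.
Proof.
move=> N2; have N0 : 2 <= N%:R :> R by rewrite ler_nat.
rewrite /tilt /level_ratio !natrM natrD natrB; last by lia.
by rewrite -natr1; field; lra.
Qed.

(** With K = N^2 the ratio is 1 - 1/K, and (1 - 1/K)^K <= 1/2 by Bernoulli's inequality for the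
    inverse K/(K-1). The barrier 2 N^2 squares this. *)
Lemma level_ratio_exp N : (2 <= N)%N -> level_ratio N ^+ (2 * (N * N)) <= 1 / 4.
Proof.
move=> N2; have /andP[r0 _] := level_ratio_bounds N2; move: r0; rewrite /level_ratio.
have -> : ((N - 1) * (N + 1) = (N * N).-1)%N by nia.
have {N2} : (1 < N * N)%N by nia.
move: (N * N)%N => K K1 r0.
have Kr : 0 < K%:R :> R by rewrite ltr0n; lia.
have K1r : 0 < K.-1%:R :> R by rewrite ltr0n; lia.
have E : K%:R = K.-1%:R + 1 :> R by rewrite natr1 prednK//; lia.
have half : (K.-1%:R / K%:R) ^+ K <= 1 / 2 :> R.
  have H2 : 2 <= (K%:R / K.-1%:R) ^+ K :> R.
    have -> : K%:R / K.-1%:R = 1 + K.-1%:R^-1 :> R by rewrite E; field; lra.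
    have i0 : 0 <= (K.-1%:R : R)^-1 by rewrite invr_ge0 ltW.
    apply: le_trans (bernoulli_ineq K i0).
    by rewrite E mulrDr mulVf ?gt_eqF//; lra.
  rewrite -invf_div exprVn div1r lef_pV2// posrE; lra.
rewrite mulnC exprM; apply: le_trans (_ : (1 / 2) ^+ 2 <= _); last by lra.
by rewrite lerXn2r// nnegrE ?exprn_ge0//; lra.
Qed.

End Constants.


(** * Analysis of the walk *)

Section Factory.
Variables (R : realType) (w : nat) (G : sgraph) (L : labeling G) (e : G * G).
Notation runs := (@runs R w G L e).
Variables (n m b T : nat) (u : G) (v1 : option G).
Hypothesis n2 : (2 <= n)%N.
Hypothesis nw : (4 * (n * n) < 2 ^ w)%N.
Hypothesis deg_le : forall v : G, (degree v <= n)%N.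
Hypothesis deg_gt0 : (0 < degree u)%N.
Hypothesis mostly_light : (3 * degree u <= 4 * light_degree T u)%N.
Notation d := (degree u).
Notation p := (light_fraction R T u).

Lemma light_fraction_bounds : 3 / 4 <= p <= 1.
Proof.
have d0 : 0 < d%:R :> R by rewrite ltr0n.
rewrite /p ler_pdivlMr// ler_pdivrMr// mul1r ler_nat light_degree_le andbT.
by move: mostly_light; rewrite -(ler_nat R) !natrM; lra.
Qed.

Lemma tilt_fraction_bounds N : (2 <= N)%N -> 0 <= tilt R N / p <= 1.
Proof.
move=> /(tilt_bounds R); move: light_fraction_bounds => /andP[? ?] /andP[? ?].
apply/andP; split; first by apply: divr_ge0; lra.
by rewrite ler_pdivrMr; lra.
Qed.

(* Expected remaining time of the walk. The weight of the barrier 2 N^2 pays   *)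
(* for the coins tossed there, of which all succeed with probability at most   *)
(* 1/4; the last term pays for the exact count at level n, reached from level  *)
(* N with probability at most 4^(N - n).                                        *)
Definition potential (i N : nat) : R :=
  128 * (4 * N%:R ^+ 2 - i%:R) + 10 * n%:R / 4 ^+ (n - N).

Let w1 : (1 < 2 ^ w)%N.
Proof. by apply: leq_ltn_trans nw; nia. Qed.

Let degw (v : G) : (degree v < 2 ^ w)%N.
Proof. by have := deg_le v; nia. Qed.

Lemma runs_walk_step t ks r x i N k A B dL c f v2 (h V : nat -> R) :
  (0 < i < k)%N -> (k < 2 ^ w)%N -> (2 <= N <= n)%N ->
  (forall r x v2 i', (i' <= k)%N ->
    runs t ks (memory n m b T d r x i' N 1 k 1 A B dL c f) [:: Some u; v1; v2]
      (h i') (V i')) ->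
  runs t (walk_step :: ks) (memory n m b T d r x i N 1 k 1 A B dL c f)
    [:: Some u; v1; v2]
    (h i + (tilt R N * (h i.-1 - h i) + p * (h i.+1 - h i)) / 2)
    (V i + (tilt R N * (V i.-1 - V i) + p * (V i.+1 - V i)) / 2 + 12).
Proof.
move=> /andP[i0 ik] kw /andP[N2 Nn] H; rewrite /walk_step.
have dp : d%:R != 0 :> R by rewrite pnatr_eq0 -lt0n.
step_seq; apply: (@runs_rand _ _ _ _ _ _ _ _ _ _ _
  (fun r => if (r < 1)%N then h i + p * (h i.+1 - h i)
            else h i + tilt R N * (h i.-1 - h i))
  (fun r => if (r < 1)%N then V i + p * (V i.+1 - V i) + 10
            else V i + tilt R N * (V i.-1 - V i) + 10)) => //.
- move=> [_|r' _]; rewrite [set_nth _ _ _ _]/=; apply: runs_if => //=.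
    step_seq; apply: (runs_rand_neighbor (u := u)
      (h' := fun y => if (degree y < T)%N then h i.+1 else h i)
      (V' := fun y => if (degree y < T)%N then V i.+1 + 5 else V i + 5)) => //.
    - by rewrite deg_gt0 ltnW.
    - move=> r' y uy; rewrite [set_nth _ _ _ _]/= [set_nth None _ _ _]/=.
      step_seq; apply: runs_qdegree => //; rewrite [set_nth _ _ _ _]/=.
      step_seq; step_op; first exact: ltn_w.
      step_op; first by case: ltnP; lia.
      case: ltnP => _ /=; rewrite ?addn1 ?addn0;
        by apply: runs_weaken (H _ _ _ _ _) _ _; [lia|lra|lra].
    - rewrite sum_light /light_fraction; le_eq; field; exact: dp.
    - rewrite sum_light /light_fraction.
      rewrite [X in X + 3](_ : _ = V i + 5 +
        (light_degree T u)%:R / d%:R * (V i.+1 - V i)); first lra.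
      by field; exact: dp.
  have N2' : 2 <= N%:R :> R by rewrite ler_nat.
  step_seq; step_op; first by nia.
  step_seq; step_op; first by nia.
  step_seq; apply: (@runs_rand _ _ _ _ _ _ _ _ _ _ _
    (fun r => if (r < N - 1)%N then h i.-1 else h i)
    (fun r => if (r < N - 1)%N then V i.-1 + 3 else V i + 3)) => //=.
  - by nia.
  - move=> r2 _; step_seq; step_op; first exact: ltn_w.
    step_op; first by case: ltnP; lia.
    case: ltnP => _ /=; rewrite ?subn1 ?subn0;
      by apply: runs_weaken (H _ _ _ _ _) _ _; [lia|lra|lra].
  - rewrite mean_ltn//; [|lia|lia].
    by rewrite /tilt natrM natrB; [lra|lia].
  - rewrite mean_ltn//; [|lia|lia].
    by rewrite /tilt natrM natrB; [lra|lia].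
- by rewrite [nth _ _ _]/= mean_ltn//; lra.
- by rewrite [nth _ _ _]/= mean_ltn//; lra.
Qed.

Lemma runs_level_cheap t ks r x i N k A B dL c f v2 h V : 
  (2 <= N < n)%N ->
  runs t ks (memory n m b T d r x i N 1 k 1 ((N - 1) * (N + 1)) (N * N) dL c 1)
     [:: Some u; v1; v2] h V ->
  runs t (level_coin :: ks) (memory n m b T d r x i N 1 k 1 A B dL c f)
    [:: Some u; v1; v2] h (V + 10).
Proof.
move=> /andP[N2 Nn] H; rewrite /level_coin.
step_seq; step_op; first exact: ltn_w.
apply: runs_if => //; rewrite [nth _ _ _]/= Nn.
step_seq; step_op; first by nia.
step_seq; step_op; first by nia.
step_seq; step_op; first by nia.
step_op; first by nia.
by apply: runs_weaken H _ _; lra.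
Qed.

Lemma runs_level_exact t ks r x i k A B dL c f v2 h V : 
  (forall x v2, 
  runs t ks (memory n m b T d r x i n 1 k 1 ((n - 1) * d) (n * 2 * light_degree T u)
    (light_degree T u) 0 0) [:: Some u; v1; v2] h V) ->
  runs t (level_coin :: ks) (memory n m b T d r x i n 1 k 1 A B dL c f)
    [:: Some u; v1; v2] h (V + 10 * d%:R + 16).
Proof.
move=> H; rewrite /level_coin.
step_seq; step_op; first exact: ltn_w.
apply: runs_if => //; rewrite [nth _ _ _]/= ltnn.
step_seq; apply: runs_weaken (runs_count_light w1 (h := h) (V := V + 7) degw _) _ _;
  [|by []|lra].
have := deg_le u; have := light_degree_le T u => ? ?.
move=> x' v2'; step_seq; step_op; first by nia.
step_seq; step_op; first by nia.
step_seq; step_op; first by nia.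
step_op; first by nia.
by apply: runs_weaken (H _ _) _ _; lra.
Qed.

Lemma potential_ge1 i N : (2 <= N)%N -> (i <= N * N * 2)%N -> 1 <= potential i N.
Proof.
move=> N2 iN; rewrite /potential.
have : 0 <= 10 * n%:R / 4 ^+ (n - N) :> R by rewrite divr_ge0// mulr_ge0.
have : i%:R <= N%:R * N%:R * 2 :> R by rewrite -!natrM ler_nat.
have : 4 <= N%:R * N%:R :> R by rewrite -natrM ler_nat; nia.
by rewrite expr2; lra.
Qed.

(** The upward drift is at least (3/4 - 1/2)/2 = 1/8, and the weight 128 turns it into 16, the cost
    of one loop iteration. *)
Lemma potential_step i N : (2 <= N)%N -> (0 < i)%N ->
  (tilt R N * (potential i.-1 N - potential i N) +
   p * (potential i.+1 N - potential i N)) / 2 <= - 16.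
Proof.
case: i => // i /(tilt_bounds R)/andP[_ t1] _; rewrite /potential.
rewrite -[i.+2%:R]natr1 -[i.+1%:R]natr1 [_.-1]/=; move: (10 * _ / _) => Z.
by have /andP[p1 _] := light_fraction_bounds; lra.
Qed.

(** The factor 1/4 bounds the survival probability at the barrier; it offsets the higher barrier of
    the next level and exactly matches the growth of the term for the final count. *)
Lemma potential_level N : (2 <= N < n)%N ->
  24 * (N * N)%:R + 24 + potential (N * N * 2) N.+1 / 4 <= potential (N * N * 2) N.
Proof.
move=> /andP[N2 Nn]; rewrite /potential.
have -> : (n - N = (n - N.+1).+1)%N by lia.
rewrite [4 ^+ _.+1]exprS invfM !natrM -[N.+1%:R]natr1.
have N2' : 2 <= N%:R :> R by rewrite ler_nat.
move: (_ ^-1) => Z; move: N2'; move: (N%:R : R) => x ?.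
by rewrite !expr2; nra.
Qed.

Lemma potential_last :
  10 * d%:R + 24 * (n * n)%:R + 30 <= potential (n * n * 2) n.
Proof.
rewrite /potential subnn expr0 divr1.
have : d%:R <= n%:R :> R by rewrite ler_nat.
have : 4 <= n%:R * n%:R :> R by rewrite -natrM ler_nat; nia.
by rewrite !natrM expr2; lra.
Qed.

Lemma runs_next_level t ks r x i N acc A B dL c v2 h V :
  (2 <= N < n)%N ->
  runs t ks (memory n m b T d r x i N.+1 1 (N.+1 * N.+1 * 2) acc A B dL c 1)
    [:: Some u; v1; v2] h V ->
  runs t (next_level :: ks) (memory n m b T d r x i N 1 0 acc A B dL c 1)
    [:: Some u; v1; v2] h (V + 6).
Proof.
move=> /andP[N2 Nn] H; rewrite /next_level.
apply: runs_if => //; rewrite [nth _ _ _]/=.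
step_seq; step_op; first by nia.
step_seq; step_op; first by nia.
step_op; first by nia.
by rewrite addn1; apply: runs_weaken H _ _; lra.
Qed.

(* The walk accepts with probability (tilt N / p)^i. *)
Notation value h0 h1 i N := (h0 + (h1 - h0) * (tilt R N / p) ^+ i).

(** Gambler's ruin: ([tilt N] / p)^i is harmonic for down rate [tilt N] and up rate p. *)
Lemma value_step h0 h1 i N : (0 < i)%N ->
  tilt R N * (value h0 h1 i.-1 N - value h0 h1 i N) +
  p * (value h0 h1 i.+1 N - value h0 h1 i N) = 0.
Proof.
case: i => // i _; rewrite -[i.+1.-1]/i !exprS.
have /andP[p1 _] := light_fraction_bounds.
by field; lra.
Qed.

Lemma value_le1 h0 h1 i N : (2 <= N)%N -> h0 <= 1 -> h1 <= 1 -> value h0 h1 i N <= 1.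
Proof.
move=> /tilt_fraction_bounds/andP[q0 q1] H0 H1.
have := exprn_ge0 i q0; have := exprn_ile1 i q0 q1.
by move: (_ ^+ i) => X ? ?; nra.
Qed.

Lemma value_ge0 h0 h1 i N : (2 <= N)%N -> 0 <= h0 -> 0 <= h1 -> 0 <= value h0 h1 i N.
Proof.
move=> /tilt_fraction_bounds/andP[q0 q1] H0 H1.
have := exprn_ge0 i q0; have := exprn_ile1 i q0 q1.
by move: (_ ^+ i) => X ? ?; nra.
Qed.

Lemma exact_coin :
  ((n - 1) * d)%:R / (n * 2 * light_degree T u)%:R = tilt R n / p.
Proof.
have d0 : d%:R != 0 :> R by rewrite pnatr_eq0 -lt0n.
have n0 : n%:R != 0 :> R by rewrite pnatr_eq0 -lt0n ltnW.
have l0 : (light_degree T u)%:R != 0 :> R.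
  by rewrite pnatr_eq0 -lt0n; move: mostly_light deg_gt0; clear; lia.
rewrite /light_fraction /tilt !natrM natrB; last exact: ltnW.
by field; rewrite n0 d0 l0.
Qed.

(** [h1], [V1] describe the continuation after acceptance and [h0], [V0] after rejection. Both are
    assumed at any level and barrier, as the walk may stop at any of them. *)
Lemma runs_walk t ks h0 h1 V0 V1 :
  (forall r x N k A B dL c f v2,
    runs t ks (memory n m b T d r x 0 N 1 k 1 A B dL c f) [:: Some u; v1; v2]
      h1 V1) ->
  (forall r x N k A B dL c f v2,
    runs t ks (memory n m b T d r x 0 N 1 k 0 A B dL c f) [:: Some u; v1; v2]
      h0 V0) ->
  forall i N, (2 <= N <= n)%N -> (i <= N * N * 2)%N -> forall r x A B dL c f v2,
  runs t (walk :: ks)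
    (memory n m b T d r x i N 1 (N * N * 2) 1 A B dL c f) [:: Some u; v1; v2]
    (value h0 h1 i N) (value V0 V1 i N + potential i N).
Proof.
have square_lt N : (N <= n)%N -> (N * N * 2 < 2 ^ w)%N.
  by move: nw; clear; nia.
elim: t => [|t IH] H1 H0 i N /andP[N2 Nn] iN r x A B dL c f v2.
all: have [h11 h01] := (runs_le1 (H1 0 0 0 0 0 0 0 0 0 None)%N,
                        runs_le1 (H0 0 0 0 0 0 0 0 0 0 None)%N).
all: have [V10 V00] := (runs_ge0 (H1 0 0 0 0 0 0 0 0 0 None)%N,
                        runs_ge0 (H0 0 0 0 0 0 0 0 0 0 None)%N).
all: have V1' := potential_ge1 N2 iN.
all: have V0' := value_ge0 i N2 V00 V10.
all: have h1' := value_le1 i N2 h01 h11.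
all: have [i0|i0] := posnP i; first by
  rewrite i0 in V1' *; apply: runs_exit => //;
  apply: runs_weaken (H1 _ _ _ _ _ _ _ _ _ _) _ _; rewrite expr0; lra.
all: apply: runs_loop; [by []|by rewrite -lt0n|by []|by lra|] => // t' [<-] {t'}.
have {}H1 := fun r x N k A B dL c f v2 => runs_le (leqnSn t) (H1 r x N k A B dL c f v2).
have {}H0 := fun r x N k A B dL c f v2 => runs_le (leqnSn t) (H0 r x N k A B dL c f v2).
have {}IH := IH H1 H0.
step_seq; step_op; first exact: ltn_w.
apply: runs_if => //; rewrite [nth _ _ _]/=.
have [ik|ki] := ltnP i (N * N * 2).
  apply: runs_weaken.
    apply: (runs_walk_step (h := fun i => value h0 h1 i N)
      (V := fun i => value V0 V1 i N + potential i N)).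
    - by rewrite i0.
    - exact: square_lt.
    - by rewrite N2.
    - move=> r' x' v2' i' i'k; apply: IH => //; first by rewrite N2.
  - by cbv beta; rewrite value_step// mul0r addr0 lexx.
  - cbv beta; have := value_step V0 V1 N i0; have := potential_step N2 i0.
    move: (value V0 V1 i N) (value V0 V1 i.-1 N) (value V0 V1 i.+1 N) => a a1 a2.
    move: (potential i N) (potential i.-1 N) (potential i.+1 N) => b0 b1 b2.
    by lra.
have iE : i = (N * N * 2)%N by apply/eqP; rewrite eqn_leq iN ki.
rewrite -iE; have ratio01 := level_ratio_bounds R N2.
(* Surviving [i] coins of bias [level_ratio N] and going on with [tilt N.+1] gives exactly the
   acceptance probability owed at level N. *)
have ratE : (tilt R N / p) ^+ i = (tilt R N.+1 / p) ^+ i * level_ratio R N ^+ i.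
  by rewrite tilt_level_ratio// -exprMn mulrAC.
step_seq; move: Nn; rewrite leq_eqVlt => /predU1P[NE|Nn]; last first.
  apply: runs_weaken.
    apply: (runs_level_cheap (h := value h0 h1 i N)
      (V := value V0 V1 i N + potential i N - 15)); first by rewrite N2.
    step_seq; apply: runs_weaken.
      apply: (runs_flips w1 (h0 := h0) (V0 := V0 + 7)
        (h1 := value h0 h1 i N.+1)
        (V1 := value V0 V1 i N.+1 + potential i N.+1 + 6)).
      - by move: N2; clear; nia.
      - have := square_lt _ (ltnW Nn); move: N2; clear; nia.
      - by rewrite iE square_lt// ltnW.
      - exact: w1.
      - move=> r'; apply: runs_next_level; first by rewrite N2.
        by apply: IH; [rewrite Nn leqW|rewrite iE !leq_mul].
      (* After a failed toss the level is still raised, but the position is already 0 and the walk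
         stops. *)
      - move=> r'; apply: runs_weaken (runs_next_level (h := h0) (V := V0 + 1) _ _) _ _;
          [by rewrite N2| |by []|lra].
        by apply: runs_exit => //; apply: runs_weaken (H0 _ _ _ _ _ _ _ _ _ _) _ _; lra.
      - by rewrite iE square_lt// ltnW.
    + by rewrite -/(level_ratio R N) ratE; le_eq; ring.
    + rewrite -/(level_ratio R N) ratE.
      have P1 : 1 <= potential i N.+1 
        by apply: potential_ge1; [exact: leqW|rewrite iE !leq_mul].
      have := potential_level (N := N); rewrite N2 Nn -iE => /(_ isT).
      have iEr : i%:R = (N * N)%:R * 2 :> R by rewrite iE natrM.
      have := level_ratio_exp R N2; rewrite mulnC -iE iEr.
      have : 0 <= level_ratio R N ^+ i by apply: exprn_ge0; case/andP: ratio01.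
      move: (level_ratio R N ^+ i) ((tilt R N.+1 / p) ^+ i) P1 => Y X.
      move: (potential i N.+1) (potential i N) ((N * N)%:R : R) => P1 P0 K P1_ge1 Y0 Y1 PP.
      have : (1 / 4 - Y) * P1 >= 0 by rewrite mulr_ge0//; lra.
      lra.
  - by [].
  - lra.
(* At level n the coins have the exact bias, so the tosses settle the verdict. *)
subst N.
apply: runs_weaken.
  apply: (runs_level_exact (h := value h0 h1 i n)
    (V := value V0 V1 i n + 3 + 12 * i%:R + 2)) => x' v2'.
  step_seq; apply: runs_weaken.
    apply: (runs_flips w1 (h0 := h0) (V0 := V0 + 3) (h1 := h1) (V1 := V1 + 3)).
    - by move: mostly_light; clear; nia.
    - have := light_degree_le T u; have := deg_le u.
      by move: mostly_light deg_gt0 n2 nw; clear; nia.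
    - by rewrite iE square_lt.
    - exact: w1.
    - move=> r'; apply: runs_if => //; rewrite [nth _ _ _]/=.
      apply: runs_const => //; first exact: ltn_w false.
      by apply: runs_exit => //; apply: runs_weaken (H1 _ _ _ _ _ _ _ _ _ _) _ _; lra.
    - move=> r'; apply: runs_if => //; rewrite [nth _ _ _]/=.
      apply: runs_const => //; first exact: ltn_w false.
      by apply: runs_exit => //; apply: runs_weaken (H0 _ _ _ _ _ _ _ _ _ _) _ _; lra.
    - by rewrite iE square_lt.
  - by rewrite exact_coin.
  - by rewrite exact_coin; move: (_ ^+ i) => X; lra.
- by [].
- have := potential_last; rewrite -iE.
  have iEr : i%:R = (n * n)%:R * 2 :> R by rewrite iE natrM.
  rewrite iEr.
  move: (value V0 V1 i n) (potential i n) => a a'.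
  lra.
Qed.

End Factory.


(** * Counting edges by degrees *)

Section Handshake.
Variable G : sgraph.

(** Each edge has exactly two orientations, which form the fibre of [F] over it. *)
Lemma sum_degree : (\sum_(v : G) degree v = 2 * #|edges G|)%N.
Proof.
rewrite (_ : (\sum_(v : G) degree v)%N = (\sum_(uv : G * G | adj uv.1 uv.2) 1)%N); last first.
  rewrite -(pair_big_dep xpredT (fun u v : G => adj u v) (fun _ _ => 1%N)) /=.
  by apply: eq_bigr => v _; rewrite sum1dep_card /degree.

pose F (uv : G * G) : {set G} := [set uv.1; uv.2].
rewrite (partition_big F (mem (edges G))) /=; last first.
  by move=> uv uvE; apply/imsetP; exists uv; rewrite ?inE.
rewrite mulnC -sum_nat_const; apply: eq_bigr => E /imsetP[[u v]] /=.
rewrite inE /= => uv ->.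
have nuv : u != v by apply: contraTneq uv => ->; rewrite adj_irrefl.
have -> : 2%N = #|[set (u, v); (v, u)]|.
  by rewrite cards2 xpair_eqE negb_and nuv.
rewrite sum1dep_card; apply: eq_card => -[x y].
rewrite !inE /F /= !xpair_eqE; apply/andP/orP => [[xy /eqP E2]|]; last first.
  case=> /andP[/eqP-> /eqP->]; first by rewrite uv eqxx.
  by rewrite adj_sym uv finset.setUC eqxx.
have := set21 x y; have := set22 x y; rewrite E2 !inE.
have nxy : x != y by apply: contraTneq xy => ->; rewrite adj_irrefl.
move=> /orP[]/eqP yE /orP[]/eqP xE; move: nxy; rewrite xE yE !eqxx;
  by [left|right|].
Qed.

Lemma degree_lt_card (v : G) : (degree v < #|G|)%N.
Proof.
rewrite -cardsT; apply: proper_card; apply/fintype.properP; split; first exact: finset.subsetT.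
by exists v; rewrite !inE // adj_irrefl.
Qed.

(** Each heavy neighbor of [u] contributes at least [T] to the degree sum 2m. *)
Lemma heavy_degree_le T (u : G) :
  ((degree u - light_degree T u) * T <= 2 * #|edges G|)%N.
Proof.
rewrite -sum_degree.
have -> : (degree u - light_degree T u = #|[set y | adj u y & (T <= degree y)%N]|)%N.
  apply/eqP; rewrite -(eqn_add2r (light_degree T u)) subnK ?light_degree_le//.
  rewrite /degree -(cardsID [set y : G | (degree y < T)%N] [set y | adj u y]) addnC.
  apply/eqP; congr (_ + _)%N; apply: eq_card => y; rewrite !inE -?leqNgt//.
  by rewrite andbC.
rewrite -sum_nat_const; 
apply: leq_trans (_ : (\sum_(y in [set y | adj u y & T <= degree y])
  degree y <= _)%N).
  by apply: leq_sum => y; rewrite inE => /andP[].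
by rewrite [leqRHS](bigID (mem [set y | adj u y & (T <= degree y)%N])) leq_addr.
Qed.

End Handshake.

Section LightEdges.
Variables (R : realType) (G : sgraph) (T : nat).
Hypothesis mostly_light : forall u : G,
  (T <= degree u)%N -> (0 < light_degree T u)%N.

(** Double counting: a heavy [y] is met from [light_degree T y] light vertices, and dividing by its
    light fraction turns this count into [degree y]. *)
Lemma sum_light_edges (phi : G -> R) :
  \sum_(v : G | (degree v < T)%N) \sum_(y | adj v y)
    (if (degree y < T)%N then 0 else phi y / light_fraction R T y) =
  \sum_(y : G | (T <= degree y)%N) phi y * (degree y)%:R.
Proof.
rewrite (exchange_big_dep xpredT)//= [RHS]big_mkcond; apply: eq_bigr => y _.
rewrite ltnNge; have [Ty|yT] := leqP T (degree y); last by rewrite big1.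
rewrite sumr_const -[_ *+ _]mulr_natr.
rewrite (_ : #|_| = light_degree T y); last first.
  by apply: eq_card => v; rewrite !inE adj_sym andbC.
have l0 := mostly_light Ty; have d0 := leq_trans l0 (light_degree_le T y).
rewrite /light_fraction; field.
by rewrite !pnatr_eq0 -!lt0n l0 d0.
Qed.

End LightEdges.


(** * One attempt of the rejection sampler *)

Notation "d ::= 'copy' a" := (Do (VCopy (Direct d) (Direct a))) (at level 50).
Notation "d ::= 'vertex' a" := (Do (QVertex (Direct d) (Direct a))) (at level 50).

(** The walk starts at height 1 and level 2, with barrier 8 = 2 * 2^2, so it accepts with
    probability [tilt 2] / p = 1/(4p). *)
Definition heavy_attempt : cmd :=
  0 ::= copy 1 ;; 4 ::= degree 0 ;; 18 ::= 4 <' 3 ;;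
  If (Direct 18) (18 ::= 0)
    (7 ::= 1 ;; 8 ::= 2 ;; 10 ::= 8 ;; 11 ::= 1 ;; walk ;;
     If (Direct 11) (5 ::= random 4 ;; 1 ::= neighbor 0 5 ;; 9 ::= 0) (18 ::= 0)).

(** The split 1/5 against 4/5 balances the factor 1/4 in the acceptance of heavy sources. *)
Definition attempt : cmd :=
  5 ::= random 0 ;; 0 ::= vertex 5 ;; 4 ::= degree 0 ;; 18 ::= 4 <' 3 ;;
  If (Direct 18)
    (5 ::= random 3 ;; 6 ::= 5 <' 4 ;;
     If (Direct 6)
       (1 ::= neighbor 0 5 ;; 5 ::= 5 ;; 5 ::= random 5 ;;
        If (Direct 5) heavy_attempt (9 ::= 0))
       (18 ::= 0))
    (18 ::= 0).

Section Attempt.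
Variables (R : realType) (w : nat) (G : sgraph) (L : labeling G) (e : G * G).
Notation runs := (@runs R w G L e).
Notation n := #|G|.
Notation m := #|edges G|.
Variables (b T : nat) (W : R).
Hypothesis e_adj : adj e.1 e.2.
Hypothesis n2 : (2 <= n)%N.
Hypothesis m0 : (0 < m)%N.
Hypothesis nw : (4 * (n * n) < 2 ^ w)%N.
Hypothesis T0 : (0 < T)%N.
Hypothesis Tw : (T < 2 ^ w)%N.
Hypothesis Tm : (8 * m <= T * T)%N.
Hypothesis W0 : 0 <= W.

Let w16 : (16 < 2 ^ w)%N.
Proof. by apply: leq_ltn_trans nw; nia. Qed.

Let w1 : (1 < 2 ^ w)%N.
Proof. exact: leq_ltn_trans w16. Qed.

Let deg_le (v : G) : (degree v <= n)%N.
Proof. exact/ltnW/degree_lt_card. Qed.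

Let degw (v : G) : (degree v < 2 ^ w)%N.
Proof. by have := deg_le v; nia. Qed.

(** A heavy [u] has at most 2m/T <= T/4 <= d(u)/4 heavy neighbors. *)
Lemma mostly_light (u : G) :
  (T <= degree u)%N -> (3 * degree u <= 4 * light_degree T u)%N.
Proof. by move=> Tu; have := heavy_degree_le T u; nia. Qed.

Definition hit (u : G) : R := (u == e.1)%:R / (degree u)%:R.

Lemma sum_hit u : \sum_(y | adj u y) ((u, y) == e)%:R = (u == e.1)%:R :> R.
Proof.
case: e e_adj => a a' /= aa'.
have [->|ua] := eqVneq u a; last first.
  by rewrite big1// => y _; rewrite xpair_eqE (negbTE ua).
rewrite (bigD1 a')//= xpair_eqE !eqxx big1 ?addr0// => y /andP[_ ya].
by rewrite xpair_eqE (negbTE ya) andbF.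
Qed.

Lemma runs_halted t ws a a' v2 :
  runs t [::] ws [:: Some a; Some a'; v2] ((a, a') == e)%:R 0.
Proof.
move=> s [_ sv].
have E t' : expect w L t' (viable R e) ([::], s) = ((a, a') == e)%:R.
  elim: t' => [|t' IH]; last by rewrite expectS /mean /= big_seq1 IH divr1.
  rewrite /= /viable /outputs /running /halted /= addr0 /output /=.
  by rewrite (sv 0)// (sv 1)//= xpair_eqE; case: e => x y /=; rewrite xpair_eqE.
split; first by rewrite E.
by elim: t => [|t IH] //=; rewrite /running /= add0r /mean big_seq1 divr1.
Qed.

(** The bound is 128 * 15 + 20, since n <= 2 * 4^(n-2). *)
Lemma potential12_le : potential R n 1 2 <= 1940.
Proof.
rewrite /potential.
have : n%:R <= 2 * 4 ^+ (n - 2) :> R.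
  rewrite -natrX -natrM ler_nat -{1}(subnK n2).
  elim: (n - 2)%N => // j; rewrite expnS; lia.
have : 0 < 4 ^+ (n - 2) :> R by rewrite exprn_gt0.
move: (4 ^+ _) => Z Z0 nZ.
have : 10 * n%:R / Z <= 20 by rewrite ler_pdivrMr//; lra.
by rewrite expr2; move: (_ / Z) => Y; lra.
Qed.

Lemma runs_heavy_attempt t ks X :
  (forall d r x i N k acc A B dL c f v0 v1 v2,
    runs t ks (memory n m b T d r x i N 1 k acc A B dL c f) [:: v0; v1; v2] X W) ->
  (forall d r x i N k acc A B dL c f a a' v2,
    runs t ks (memory n m b T d r x i N 0 k acc A B dL c f)
      [:: Some a; Some a'; v2] ((a, a') == e)%:R 1) ->
  forall u d r x i N k acc A B dL c f v0 v2,
  runs t (heavy_attempt :: ks)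
    (memory n m b T d r x i N 1 k acc A B dL c f) [:: v0; Some u; v2]
    (X + if (degree u < T)%N then 0 else (hit u - X) / 4 / light_fraction R T u)
    (W + 2000 - if (degree u < T)%N then 0 else W / 4 / light_fraction R T u).
Proof.
move=> HX He u d r x i N k acc A B dL c f v0 v2; rewrite /heavy_attempt.
step_seq; apply: runs_vcopy => //; rewrite [set_nth _ _ _ _]/=.
step_seq; apply: runs_qdegree => //; rewrite [set_nth _ _ _ _]/=.
step_seq; step_op; first exact: ltn_w.
apply: runs_if => //; rewrite [nth _ _ _]/=; case: ltnP => uT.
  apply: runs_const => //; first exact: ltn_w false.
  by apply: runs_weaken (HX _ _ _ _ _ _ _ _ _ _ _ _ _ _ _) _ _; lra.
have ml := mostly_light uT; have u0 := leq_trans T0 uT.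
have /andP[p1 p2] := light_fraction_bounds R u0 ml.
step_seq; apply: runs_const => //; rewrite [set_nth _ _ _ _]/=.
step_seq; apply: runs_const; [by []|exact: leq_ltn_trans w16|rewrite [set_nth _ _ _ _]/=].
step_seq; apply: runs_const; [by []|exact: leq_ltn_trans w16|rewrite [set_nth _ _ _ _]/=].
step_seq; apply: runs_const => //; rewrite [set_nth _ _ _ _]/=.
step_seq; apply: runs_weaken.
  apply: (runs_walk n2 nw deg_le u0 ml (h0 := X) (h1 := hit u) (V0 := W + 2) (V1 := 7)
    _ _ (i := 1) (N := 2)).
  - move=> r' x' N' k' A' B' dL' c' f' v2'; apply: runs_if => //.
    step_seq; apply: (runs_rand_neighbor (u := u)
      (h' := fun y => ((u, y) == e)%:R) (V' := fun=> 2)) => //.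
    + by rewrite u0 ltnW.
    + move=> r2 y uy; rewrite [set_nth _ _ _ _]/= [set_nth None _ _ _]/=.
      apply: runs_const => //; first exact: ltn_w false.
      by apply: runs_weaken (He _ _ _ _ _ _ _ _ _ _ _ _ _ _ _) _ _; lra.
    + by rewrite sum_hit.
    + by rewrite sum_adj_const mulfK; [lra|rewrite pnatr_eq0 -lt0n].
  - move=> r' x' N' k' A' B' dL' c' f' v2'; apply: runs_if => //.
    apply: runs_const => //; first exact: ltn_w false.
    by apply: runs_weaken (HX _ _ _ _ _ _ _ _ _ _ _ _ _ _ _) _ _; lra.
  - by [].
  - by [].
- rewrite expr1 /tilt; le_eq; field; lra.
- have := potential12_le; move: (potential _ _ _ _) => P PP.
  have -> : tilt R 2 / light_fraction R T u = (4 * light_fraction R T u)^-1.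
    by rewrite /tilt; field; lra.
  have -> : W / 4 / light_fraction R T u = W * (4 * light_fraction R T u)^-1.
    by field; lra.
  have : (4 * light_fraction R T u)^-1 <= 1 by rewrite invf_le1; lra.
  have : 0 <= (4 * light_fraction R T u)^-1 by rewrite invr_ge0; lra.
  by move: (_ ^-1) => Z Z0 Z1; rewrite expr1; lra.
Qed.


(** Indices from [degree v] up to [T] name no neighbor and contribute the default [z], the value of
    a rejected attempt. *)
Lemma mean_neighbors (v : G) (f : G -> R) z : (degree v <= T)%N ->
  mean (iota 0 T) (fun r => odflt z (omap f (onth (nlabel L v) r))) =
  z + (\sum_(y | adj v y) (f y - z)) / T%:R.
Proof.
move=> vT; have T0' : T%:R != 0 :> R by rewrite pnatr_eq0 -lt0n.
set g := fun o => odflt z (omap f o).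
have E : \sum_(r <- iota 0 T) (g (onth (nlabel L v) r) - z) =
         \sum_(y | adj v y) (f y - z).
  rewrite -{1}(subnKC vT) iotaD big_cat /= [X in _ + X]big1_seq ?addr0; last first.
    move=> r /=; rewrite mem_iota add0n => /andP[dr _].
    by rewrite /g onth_default; [rewrite subrr|rewrite size_nlabel].
  rewrite -(size_nlabel L) (sum_onth _ (fun o => g o - z)).
  by rewrite (big_uniq_seq (P := adj v)) ?nlabel_uniq// => y; exact: mem_nlabel.
rewrite -E /mean size_iota sumrB big_const_seq count_predT size_iota iter_addr_0.
by rewrite -[z *+ _]mulr_natr; field.
Qed.

Lemma mean_vertices (f : G -> R) :
  mean (iota 0 n) (fun r => odflt 0 (omap f (onth (vlabel L) r))) =
  (\sum_v f v) / n%:R.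
Proof.
rewrite /mean size_iota; congr (_ / _); rewrite -(size_vlabel L).
rewrite (sum_onth _ (fun o => odflt 0 (omap f o))).
by rewrite (big_uniq_seq (P := xpredT)) ?vlabel_uniq// => v; rewrite mem_vlabel.
Qed.

Lemma sum_vertices_const (x : R) : \sum_(v : G) x = x * n%:R.
Proof. by rewrite sumr_const mulr_natr. Qed.

Notation X := (1 / (2 * m%:R) : R).

(* Deviation from the target, contributed by the light edge (v, y). *)
Definition gain (v y : G) (s : R) (phi : G -> R) : R :=
  s / 5 + 4 / 5 * (if (degree y < T)%N then 0 else phi y / 4 / light_fraction R T y).

Lemma sum_gain (s : G -> G -> R) (phi : G -> R) :
  (forall v, \sum_(y | adj v y) s v y = phi v * (degree v)%:R) ->
  \sum_(v : G | (degree v < T)%N) \sum_(y | adj v y) gain v y (s v y) phi =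
  (\sum_v phi v * (degree v)%:R) / 5.
Proof.
move=> sE; rewrite /gain.
under eq_bigr => v _ do rewrite big_split/= -mulr_suml sE -mulr_sumr.
rewrite big_split /= -mulr_suml -mulr_sumr.
rewrite (sum_light_edges _ (fun y => phi y / 4)); last first.
  by move=> u uT; have := mostly_light uT; lia.
rewrite [in RHS](bigID (fun v : G => (degree v < T)%N)) /=.
under [X in _ + 4 / 5 * X]eq_bigr => y _ do rewrite mulrAC.
rewrite -mulr_suml.
under [X in _ = (_ + X) / 5]eq_bigl => y do rewrite -leqNgt.
by field.
Qed.

Lemma sum_degree_real : \sum_(v : G) (degree v)%:R = 2 * m%:R :> R.
Proof. by rewrite -natr_sum sum_degree natrM. Qed.

(** The deviations cancel because the target gives each of the 2m directed edges mass 1/(2m), and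
    [e] is one of them. *)
Lemma sum_gain_hit :
  \sum_(v : G | (degree v < T)%N) \sum_(y | adj v y)
    gain v y (((v, y) == e)%:R - X) (fun y => hit y - X) = 0.
Proof.
have m1 : m%:R != 0 :> R by rewrite pnatr_eq0 -lt0n.
have hitE v : hit v * (degree v)%:R = (v == e.1)%:R.
  rewrite /hit; have [->|_] := eqVneq v e.1; last by rewrite !mul0r.
  rewrite divfK// pnatr_eq0 -lt0n; apply/card_gt0P; exists e.2.
  by rewrite inE.
rewrite (sum_gain (s := fun v y => ((v, y) == e)%:R - X)); last first.
  by move=> v; rewrite sumrB sum_hit mulrBl hitE sum_adj_const.
under eq_bigr => v _ do rewrite mulrBl hitE.
rewrite sumrB -mulr_sumr sum_degree_real (bigD1 e.1)//= eqxx big1 => [|v /negPf->//].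
by rewrite addr0 divfK ?mulf_neq0 ?pnatr_eq0 ?subrr ?mul0r// -lt0n.
Qed.

Lemma sum_gain1 :
  \sum_(v : G | (degree v < T)%N) \sum_(y | adj v y) gain v y 1 (fun=> 1) =
  2 * m%:R / 5.
Proof.
rewrite (sum_gain (s := fun v y => 1)); last first.
  by move=> v; rewrite sum_adj_const.
by under eq_bigr do rewrite mul1r; rewrite sum_degree_real.
Qed.

Hypothesis W_large : 2100 * (5 * (n%:R * T%:R)) <= W * (2 * m%:R).

(** If restarting is worth [X] and costs [W], then so is an attempt, with one unit of time left for
    the loop test: this is the inductive step of the outer loop. *)
Lemma runs_attempt t ks :
  (forall d r x i N k acc A B dL c f v0 v1 v2,
    runs t ks (memory n m b T d r x i N 1 k acc A B dL c f) [:: v0; v1; v2] X W) ->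
  (forall d r x i N k acc A B dL c f a a' v2,
    runs t ks (memory n m b T d r x i N 0 k acc A B dL c f)
      [:: Some a; Some a'; v2] ((a, a') == e)%:R 1) ->
  forall d r x i N k acc A B dL c f v0 v1 v2,
  runs t (attempt :: ks)
    (memory n m b T d r x i N 1 k acc A B dL c f) [:: v0; v1; v2] X (W - 1).
Proof.
move=> HX He d r x i N k acc A B dL c f v0 v1 v2.
pose gh v := \sum_(y | adj v y) gain v y (((v, y) == e)%:R - X) (fun y => hit y - X).
pose gV v := \sum_(y | adj v y) gain v y 1 (fun=> 1).
pose hv v := X + (if (degree v < T)%N then gh v / T%:R else 0).
pose Vv v := W + 2040 - (if (degree v < T)%N then W * (gV v / T%:R) else 0).
have n0 : n%:R != 0 :> R by rewrite pnatr_eq0 -lt0n; lia.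
have T0' : T%:R != 0 :> R by rewrite pnatr_eq0 -lt0n.
step_seq; apply: (runs_rand
  (h' := fun r => odflt 0 (omap hv (onth (vlabel L) r)))
  (V' := fun r => odflt 0 (omap Vv (onth (vlabel L) r)))) => //.
- have nn : (n <= 4 * (n * n))%N by move: n; clear; nia.
  rewrite [nth _ _ _]/= (leq_trans nn (ltnW nw)) andbT. exact: ltnW.
- move=> r1; rewrite [nth _ _ _]/= => r1n'.
  have {r1n'} r1n : (r1 < size (vlabel L))%N by rewrite size_vlabel.
  rewrite [set_nth _ _ _ _]/=; step_seq; apply: runs_qvertex => //.
  rewrite [nth _ _ _]/= [set_nth _ _ _ _]/=.
  case E : (onth (vlabel L) r1) => [v|]; last by move: r1n; rewrite -onthTE E.
  rewrite [odflt _ _]/= [odflt _ _]/=.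
  step_seq; apply: runs_qdegree => //; rewrite [set_nth _ _ _ _]/=.
  step_seq; step_op; first exact: ltn_w.
  apply: runs_if => //; rewrite [nth _ _ _]/= /hv /Vv; case: ltnP => vT; last first.
    apply: runs_const => //; first exact: ltn_w false.
    by apply: runs_weaken (HX _ _ _ _ _ _ _ _ _ _ _ _ _ _ _) _ _; lra.
  pose hy y := X + gain v y (((v, y) == e)%:R - X) (fun y => hit y - X).
  pose Vy y := W + 2020 - W * gain v y 1 (fun=> 1).
  step_seq; apply: (runs_rand
    (h' := fun r => odflt X (omap hy (onth (nlabel L v) r)))
    (V' := fun r => odflt (W + 2020) (omap Vy (onth (nlabel L v) r)))) => //.
  + by rewrite T0 ltnW.
  + move=> r2 r2T; rewrite [set_nth _ _ _ _]/=.
    step_seq; step_op; first exact: ltn_w.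
    apply: runs_if => //; rewrite [nth _ _ _]/=; case: ltnP => r2d; last first.
      rewrite onth_default ?size_nlabel//=.
      apply: runs_const => //; first exact: ltn_w false.
      by apply: runs_weaken (HX _ _ _ _ _ _ _ _ _ _ _ _ _ _ _) _ _; lra.
    step_seq; apply: (runs_qneighbor (v := v)) => //.
    rewrite [nth _ _ _]/= [set_nth _ _ _ _]/=.
    case E2 : (onth (nlabel L v) r2) => [y|]; last first.
      by move: r2d; rewrite -(size_nlabel L) -onthTE E2.
    rewrite [odflt _ _]/= [odflt _ _]/= /hy /Vy.
    step_seq; apply: runs_const; [by []|exact: leq_ltn_trans w16|].
    rewrite [set_nth _ _ _ _]/=; step_seq; apply: (runs_rand
      (h' := fun r => if (r < 1)%N then ((v, y) == e)%:R else
        X + if (degree y < T)%N then 0 else (hit y - X) / 4 / light_fraction R T y)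
      (V' := fun r => if (r < 1)%N then 3 else
        W + 2001 - if (degree y < T)%N then 0 else W / 4 / light_fraction R T y)) => //.
    * by apply: ltnW; apply: leq_ltn_trans w16.
    * move=> [_|r3 _]; rewrite [set_nth _ _ _ _]/=; apply: runs_if => //.
        apply: runs_const => //; first exact: ltn_w false.
        by apply: runs_weaken (He _ _ _ _ _ _ _ _ _ _ _ _ _ _ _) _ _; lra.
      rewrite [nth _ _ _]/=; cbv beta.
      apply: runs_weaken; first exact: (runs_heavy_attempt HX He).
        by [].
      by case: ifP => _; lra.
    * by rewrite [nth _ _ _]/= mean_ltn// /gain; case: ifP => _; lra.
    * rewrite [nth _ _ _]/= mean_ltn// /gain mul1r; case: ifP => _; first lra.
      rewrite (_ : W / 4 / _ = W * (1 / 4 / light_fraction R T y)); last by ring.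
      by move: (1 / 4 / _) => Z; lra.
  + rewrite [nth _ _ _]/= mean_neighbors; last exact: ltnW.
    by rewrite /hy /gh; under [in leRHS]eq_bigr do rewrite addrC addKr.
  + rewrite [nth _ _ _]/= mean_neighbors; last exact: ltnW.
    under eq_bigr do rewrite /Vy addrC addKr.
    rewrite sumrN -mulr_sumr mulNr -mulrA -/(gV v).
    by move: (gV v / _) => Z; lra.
- rewrite [nth _ _ _]/= mean_vertices.
  rewrite big_split /= sum_vertices_const -big_mkcond -mulr_suml.
  by rewrite sum_gain_hit mul0r addr0 mulfK.
- rewrite [nth _ _ _]/= mean_vertices.
  rewrite big_split /= sum_vertices_const sumrN -big_mkcond.
  rewrite -mulr_sumr -mulr_suml sum_gain1 mulrBl mulfK//.
  have n0' : 0 < n%:R :> R by rewrite lt_def n0 ler0n.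
  have T0r : 0 < T%:R :> R by rewrite lt_def T0' ler0n.
  (* The charge [W] is saved with probability 2m/(5nT), and this must cover the cost of the
     attempt. *)
  suff : 2100 <= W * (2 * m%:R / 5 / T%:R) / n%:R by lra.
  rewrite ler_pdivlMr// mulrA ler_pdivlMr//; move: W_large; lra.
Qed.

End Attempt.


(** * Choice of the threshold, and the complete sampler *)

(** Linear search for the ceiling of n / sqrt m: it needs no square root and stays within the time
    bound, unlike a linear search for sqrt m itself. *)
Definition scale_loop : cmd :=
  While (Direct 9)
    (2 ::= 2 +' 12 ;; 14 ::= 2 *' 2 ;; 14 ::= 14 *' 1 ;; 15 ::= 0 *' 0 ;;
     9 ::= 14 <' 15).

Definition sampler : cmd :=
  12 ::= 1 ;; 13 ::= 2 ;; 9 ::= 1 ;; scale_loop ;;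
  14 ::= 8 ;; 14 ::= 14 *' 0 ;; 14 ::= 14 /' 2 ;; 3 ::= 14 +' 12 ;;
  9 ::= 1 ;; While (Direct 9) attempt.

Section Sampler.
Variables (R : realType) (w : nat) (G : sgraph) (L : labeling G).
Notation n := #|G|.
Notation m := #|edges G|.
Notation X := (1 / (2 * m%:R) : R).
Hypothesis m0 : (0 < m)%N.
Hypothesis nw : (64 * (n * n * (n * n)) < 2 ^ w)%N.

Lemma edges_le : (2 * m <= n * n)%N.
Proof.
rewrite -sum_degree -sum_nat_const.
by apply: leq_sum => v _; exact/ltnW/degree_lt_card.
Qed.

Lemma card_ge2 : (2 <= n)%N.
Proof. by clear nw; have := edges_le; move: m0; move: n m => a b; nia. Qed.

Let nw2 : (4 * (n * n) < 2 ^ w)%N.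
Proof. by apply: leq_ltn_trans nw; have := card_ge2; move: n => a; nia. Qed.

Let w1 : (1 < 2 ^ w)%N.
Proof. by apply: leq_ltn_trans nw2; have := card_ge2; move: n => a; nia. Qed.

Lemma X_le1 : X <= 1.
Proof.
have : 1 <= m%:R :> R by rewrite ler1n.
by move=> m1; rewrite ler_pdivrMr; lra.
Qed.

Section Edge.
Variable e : G * G.
Hypothesis e_adj : adj e.1 e.2.
Notation runs := (@runs R w G L e).

Lemma runs_main t b T (W : R) d r x i N k acc A B dL c f v0 v1 v2 :
  (0 < T < 2 ^ w)%N -> (8 * m <= T * T)%N -> 1 <= W ->
  2100 * (5 * (n%:R * T%:R)) <= W * (2 * m%:R) ->
  runs t [:: While (Direct 9) attempt]
    (memory n m b T d r x i N 1 k acc A B dL c f) [:: v0; v1; v2] X W.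
Proof.
move=> /andP[T0 Tw] Tm W1 WT; have W0 : 0 <= W by lra.
elim: t d r x i N k acc A B dL c f v0 v1 v2 => [|t IH] d r x i N k acc A B dL c f v0 v1 v2.
  by apply: runs_loop => //; exact: X_le1.
apply: runs_loop => //; [exact: X_le1|move=> _ [<-]].
apply: (runs_attempt e_adj card_ge2 m0 nw2 T0 Tw Tm W0 WT) => //.
move=> *; apply: runs_exit => //; rewrite subrr; exact: runs_halted.
Qed.

Notation s := (n%:R / Num.sqrt m%:R : R).

Lemma lt_scale b : (b * b * m < n * n)%N -> b%:R < s.
Proof.
move=> bn; have m1 : 0 < m%:R :> R by rewrite ltr0n.
rewrite ltr_pdivlMr ?sqrtr_gt0// -(@ltr_pXn2r _ 2)// ?nnegrE ?mulr_ge0//.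
rewrite exprMn sqr_sqrtr; last exact: ltW.
by rewrite !expr2 -!natrM ltr_nat.
Qed.

Lemma ge_scale b : (n * n <= b * b * m)%N -> s <= b%:R.
Proof.
move=> bn; have m1 : 0 < m%:R :> R by rewrite ltr0n.
rewrite ler_pdivrMr ?sqrtr_gt0// -(@ler_pXn2r _ 2)// ?nnegrE ?mulr_ge0//.
rewrite exprMn sqr_sqrtr; last exact: ltW.
by rewrite !expr2 -!natrM ler_nat.
Qed.

Lemma scale_ge1 : 1 <= s.
Proof.
rewrite ltW//; apply: (@lt_scale 1); rewrite !mul1n.
by have := edges_le; lia.
Qed.

Lemma runs_scale t ks T d r x i N k acc dL c f vs h V :
  (forall b A B : nat, (b.+1 * b.+1 * m >= n * n)%N -> (b * b * m < n * n)%N ->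
     runs t ks (memory n m b.+1 T d r x i N 0 k acc A B dL c f) vs h V) ->
  forall b A B : nat, (b * b * m < n * n)%N ->
  runs t (scale_loop :: ks)
    (memory n m b T d r x i N 1 k acc A B dL c f) vs h (10 * (s - b%:R) + 11 + V).
Proof.
move=> H b A' B' bn; have [j jn] : exists j, (j = n - b)%N by exists (n - b)%N.
elim: j b A' B' bn jn => [|j IH] b A' B' bn jn.
  by exfalso; move: m0 bn jn; move: m n => a a'; nia.
have bn' : (b < n)%N by lia.
have em := edges_le.
have K : (b.+1 * b.+1 * m <= n * n * (n * n))%N.
  apply: leq_mul; first exact: leq_mul.
  by move: em; move: m (n * n)%N => a a'; lia.
have K2 : (b.+1 * b.+1 <= n * n)%N by apply: leq_mul.
apply: runs_unroll => //.
step_seq; step_op; first by rewrite addn1; move: nw2 bn'; move: n (2 ^ w)%N => a a'; nia.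
rewrite addn1; step_seq; step_op; first by move: nw2 K2; move: n (2 ^ w)%N => a a'; nia.
step_seq; step_op; first by apply: leq_ltn_trans K (leq_ltn_trans _ nw); rewrite leq_pmull.
step_seq; step_op; first by move: nw2; move: n (2 ^ w)%N => a a'; lia.
step_op; first exact: ltn_w.
have bs := lt_scale bn; case: ltnP => b1n.
  by apply: runs_weaken (IH b.+1 _ _ b1n _) _ _; [lia|lra|rewrite -natr1; lra].
apply: runs_exit => //; apply: runs_weaken (H _ _ _ b1n bn) _ _; lra.
Qed.


(** With B = [b.+1], T B > 8n and B^2 m <= 4 n^2 give T^2 >= 8m, while B >= n / sqrt m gives T - 1
    <= 8 sqrt m. *)
Lemma threshold_bounds b : (n * n <= b.+1 * b.+1 * m)%N -> (b * b * m < n * n)%N ->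
  let T := (8 * n %/ b.+1 + 1)%N in
  [/\ (8 * m <= T * T)%N, (T <= 8 * n + 1)%N & T%:R <= 9 * Num.sqrt m%:R :> R].
Proof.
move=> b1n bn T; have m1 : 1 <= m%:R :> R by rewrite ler1n.
have sm : 1 <= Num.sqrt m%:R :> R by rewrite -[leLHS]sqrtr1 ler_wsqrtr.
have smE : Num.sqrt m%:R * Num.sqrt m%:R = m%:R :> R by rewrite -expr2 sqr_sqrtr.
have Tlt : (8 * n < T * b.+1)%N by rewrite /T addn1 -ltn_divLR.
have Tle : ((T - 1) * b.+1 <= 8 * n)%N by rewrite /T addnK leq_divM.
have em := edges_le.
(* For positive [b], [b.+1] is at most twice [b]; for b = 0 the bound 2m <= n^2 is used. *)
have b4 : (b.+1 * b.+1 * m <= 4 * (n * n))%N.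
  by case: b bn {b1n T Tlt Tle} => [|b]; move: em; move: m n => a a'; nia.
split.
- move: Tlt b4; move: m n T b.+1 {em bn b1n Tle m1 sm smE} => a a' T' b' H1 H2.
  have b0 : (0 < b' * b')%N by nia.
  rewrite -(leq_pmul2l b0); nia.
- by rewrite /T leq_add2r leq_div.
have T1 : (1 <= T)%N by rewrite /T addn1.
have := ge_scale b1n.
rewrite ler_pdivrMr; last lra.
move: Tle; rewrite -(ler_nat R) !natrM natrB//.
have b0 : 0 < b.+1%:R :> R by rewrite ltr0n.
move: sm; move: (Num.sqrt _) (T%:R : R) (b.+1%:R : R) (n%:R : R) b0 => z T' b' n' b0 z1 H1 H2.
suff : (T' - 1) * b' <= 8 * z * b' by rewrite ler_pM2r//; lra.
lra.
Qed.

Lemma runs_sampler t :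
  runs t [:: sampler]
    [:: n; m; 0; 0; 0; 0; 0; 0; 0; 0; 0; 0; 0; 0; 0; 0; 0; 0; 0]%N
    [:: None; None; None] X (480 * 100 * s).
Proof.
have s1 := scale_ge1; have n2 := card_ge2.
have w16 : (16 < 2 ^ w)%N by move: nw2 n2; move: n (2 ^ w)%N => a a'; nia.
step_seq; apply: runs_const => //; rewrite [set_nth _ _ _ _]/=.
step_seq; apply: runs_const; [by []|exact: leq_ltn_trans w16|rewrite [set_nth _ _ _ _]/=].
step_seq; apply: runs_const => //; rewrite [set_nth _ _ _ _]/=.
step_seq; apply: runs_weaken.
  apply: (@runs_scale _ _ _ _ _ _ _ _ _ _ _ _ _ _ _ (475 * 100 * s + 12)); last first.
    by rewrite muln0 muln_gt0 andbb; apply: ltnW n2.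
  move=> b A B b1n bn; have [Tm Tn Tr] := threshold_bounds b1n bn.
  have nn : (8 * n + 1 < 2 ^ w)%N.
    apply: leq_ltn_trans nw; have : (n <= n * n * (n * n))%N.
      by rewrite -mulnA leq_pmulr// !muln_gt0 !(ltnW n2).
    by move: n2; move: n (n * n * (n * n))%N => a a'; lia.
  step_seq; apply: runs_const; [by []|exact: leq_ltn_trans w16|rewrite [set_nth _ _ _ _]/=].
  step_seq; step_op; first by apply: leq_ltn_trans nn; rewrite leq_addr.
  step_seq; step_op.
    by apply: leq_ltn_trans (leq_div _ _) _; apply: leq_ltn_trans nn; rewrite leq_addr.
  step_seq; step_op; first exact: leq_ltn_trans nn.
  step_seq; apply: runs_const => //; rewrite [set_nth _ _ _ _]/=.
  apply: runs_weaken.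
    (* With T <= 9 sqrt m, 2100 * 5 * 9 = 94500 has to be at most 2 * 47500. *)
    apply: (@runs_main _ _ _ (475 * 100 * s)) => //.
    - by rewrite addn1 /= -addn1 (leq_ltn_trans Tn nn).
    - by lra.
    - move: Tr; set T := (_ %/ _ + 1)%N => Tr.
      have m1 : 1 <= m%:R :> R by rewrite ler1n.
      have sm : 1 <= Num.sqrt m%:R :> R by rewrite -[leLHS]sqrtr1 ler_wsqrtr.
      have smE : Num.sqrt m%:R * Num.sqrt m%:R = m%:R :> R by rewrite -expr2 sqr_sqrtr.
      have sE : s * m%:R = n%:R * Num.sqrt m%:R.
        by rewrite -{2}smE mulrA divfK//; lra.
      have : n%:R * T%:R <= n%:R * (9 * Num.sqrt m%:R) :> R by rewrite ler_wpM2l.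
      have : 0 <= n%:R * Num.sqrt m%:R :> R by rewrite mulr_ge0.
      rewrite -[_ * s * _]mulrA [s * _]mulrCA sE.
      by move: (Num.sqrt _) => z; lra.
  - by [].
  - by lra.
- by [].
- by lra.
Qed.

End Edge.

(** * From lower bounds at finite times to the limit distribution *)

Let c0 := init w G sampler n m.

Lemma ensures_sampler e t : adj e.1 e.2 ->
  ensures w L e t c0 X (480 * 100 * (n%:R / Num.sqrt m%:R)).
Proof.
move=> e_adj; apply: (runs_sampler e_adj); split; last by move=> [|[|[|]]].
have mw : (m < 2 ^ w)%N.
  by have := edges_le; move: nw2; move: n m (2 ^ w)%N => a a' b; nia.
have nw1 : (n < 2 ^ w)%N.
  by have := card_ge2; move: nw2; move: n (2 ^ w)%N => a b; nia.
by do 19 (case; first by rewrite /= ?modn_small); move=> ? /=.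
Qed.

Let D t : R := expect w L t (running R (G := G)) c0.

Lemma output_by_ge t e : adj e.1 e.2 -> X - D t <= output_by w L R t c0 e.
Proof.
move=> /(ensures_sampler t)[+ _]; rewrite /viable expectD.
by rewrite lerBlDr; apply.
Qed.

Lemma output_by_ge0 t e : 0 <= output_by w L R t c0 e.
Proof.
by rewrite -(expect_const w L t 0 c0); apply: ler_expect => c'; rewrite ler0n.
Qed.

Lemma sum_output_by_le1 t : \sum_(e : G * G) output_by w L R t c0 e <= 1.
Proof.
rewrite -expect_sum -[leRHS](expect_const w L t 1 c0); apply: ler_expect => c'.
have [hc|_] := boolP (halted c'); last by rewrite big1.
have [[[u v] uv]|no] := pselect (exists e : G * G, output c' = (Some e.1, Some e.2)).
  rewrite (bigD1 (u, v))//= big1 ?addr0; first by rewrite lern1 leq_b1.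
  by move=> [u' v'] /= /negPf e'; rewrite uv /=; case: eqP => // -[uu vv]; rewrite uu vv eqxx in e'.
rewrite big1// => e _; case: eqP => // E.
by case: no; exists e.
Qed.

Lemma edge_exists : exists e : G * G, adj e.1 e.2.
Proof.
have /card_gt0P[E /imsetP[uv]] := m0.
by rewrite inE => uvE _; exists uv.
Qed.

Local Open Scope classical_set_scope.

(** The partial sums of [D] are the expected times, which are bounded; hence the terms vanish. *)
Lemma D_cvg0 : D t @[t --> \oo] --> (0 : R).
Proof.
apply: cvg_series_cvg_0; apply: nondecreasing_is_cvgn.
  apply/nondecreasing_seqP => t; rewrite /series /=.
  by rewrite -!time_beforeE; exact: time_beforeS.
have [uv uvE] := edge_exists.
exists (480 * 100 * (n%:R / Num.sqrt m%:R)) => _ [t _ <-].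
by rewrite /series /= -time_beforeE; case: (ensures_sampler t uvE).
Qed.

Lemma card_directed_edges : \sum_(e : G * G | adj e.1 e.2) X = 1.
Proof.
rewrite -(pair_big_dep xpredT (fun u v : G => adj u v) (fun _ _ => X)) /=.
under eq_bigr do rewrite sum_adj_const.
rewrite -mulr_sumr sum_degree_real; field.
by rewrite pnatr_eq0 -lt0n.
Qed.

(** The other directed edges already take their lower bounds out of a total mass of at most 1. *)
Lemma output_by_le t e :
  output_by w L R t c0 e <= (if adj e.1 e.2 then X else 0) + 2 * m%:R * D t.
Proof.
have D0 : 0 <= D t.
  by rewrite -(expect_const w L t 0 c0); apply: ler_expect => c'; rewrite ler0n.
pose g (e' : G * G) := if adj e'.1 e'.2 then X - D t else 0.
have sum_g : \sum_(e' : G * G) g e' = 1 - 2 * m%:R * D t.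
  rewrite -big_mkcond sumrB card_directed_edges; congr (_ - _).
  rewrite -(pair_big_dep xpredT (fun u v : G => adj u v) (fun _ _ => D t)) /=.
  under eq_bigr do rewrite sum_adj_const.
  by rewrite -mulr_sumr sum_degree_real mulrC.
have g_le : \sum_(e' | e' != e) g e' <= \sum_(e' | e' != e) output_by w L R t c0 e'.
  apply: ler_sum => e' _; rewrite /g; case: ifP => [/output_by_ge//|_].
  exact: output_by_ge0.
have := sum_output_by_le1 t; rewrite (bigD1 e)//=.
move: sum_g; rewrite (bigD1 e)//= /g; case: ifP => _; lra.
Qed.


Lemma output_by_cvg e :
  output_by w L R t c0 e @[t --> \oo] --> (if adj e.1 e.2 then X else 0 : R).
Proof.
set l : R := if _ then _ else _.
apply: (@squeeze_cvgr _ _ _ _ (fun t => l - D t) (fun t => l + 2 * m%:R * D t)).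
- near=> t; rewrite output_by_le andbT /l.
  case: ifP => [/output_by_ge//|_]; rewrite sub0r.
  apply: le_trans (output_by_ge0 t e); rewrite oppr_le0.
  by rewrite -(expect_const w L t 0 c0); apply: ler_expect => c'; rewrite ler0n.
- rewrite -[l in _ --> l]subr0; apply: cvgB; [exact: cvg_cst|exact: D_cvg0].
- rewrite -[l in _ --> l]addr0 -[X in l + X](mulr0 (2 * m%:R)).
  apply: cvgD; first exact: cvg_cst.
  apply: cvgM; [exact: cvg_cst|exact: D_cvg0].
Unshelve. all: by end_near. Qed.

Lemma expected_le (f : config G -> R) :
  (forall c, 0 <= f c <= running R c) ->
  (\sum_(0 <= t <oo) (expect w L t f c0)%:E <=
   (480 * 100 * (n%:R / Num.sqrt m%:R))%:E)%E.
Proof.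
move=> f01; apply: lime_le.
  apply: is_cvg_nneseries => t _ _; rewrite lee_fin -(expect_const w L t 0 c0).
  by apply: ler_expect => c'; case/andP: (f01 c').
apply: nearW => t; rewrite sumEFin lee_fin.
have [uv uvE] := edge_exists; case: (ensures_sampler t uvE) => _.
apply: le_trans; rewrite time_beforeE.
by apply: ler_sum => i _; apply: ler_expect => c'; case/andP: (f01 c').
Qed.

End Sampler.

Local Open Scope classical_set_scope.

Theorem theorem4 :
  exists (p : cmd) (c C : nat),
    forall (R : realType) (n m w : nat) (G : sgraph) (L : labeling G),
      #|G| = n -> #|edges G| = m -> (1 <= m)%N -> (n ^ c <= 2 ^ w)%N ->
      let c0 := init w G p n m in
      let bound : R := C%:R * (n%:R / Num.sqrt m%:R) in
      [/\ forall u v : G,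
            output_by w L R t c0 (u, v) @[t --> \oo] -->
              (if adj u v then 1 / (2 * m%:R) else 0 : R),
          (expected_queries w L R c0 <= bound%:E)%E
        & (expected_time w L R c0 <= bound%:E)%E].
Proof.
(* The exponent 12 suffices for word size: n^12 >= 2^8 n^4 > 64 n^4 as n >= 2. *)
exists sampler, 12%N, (480 * 100)%N => R n m w G L nG mE m1 nw c0 bound.
subst n m.
have nw' : (64 * (#|G| * #|G| * (#|G| * #|G|)) < 2 ^ w)%N.
  apply: leq_trans nw; have := card_ge2 m1; move: #|G| => a a2.
  have -> : (a * a * (a * a) = a ^ 4)%N by rewrite !expnS expn0 muln1 !mulnA.
  rewrite (expnD a 8 4) ltn_pmul2r; last by rewrite expn_gt0 (ltnW a2).
  by apply: (@leq_trans (2 ^ 8)) => //; rewrite leq_exp2r.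
rewrite /bound natrM; split.
- by move=> u v; apply: (@output_by_cvg _ _ _ _ m1 nw' (u, v)).
- apply: (@expected_le _ _ _ L m1 nw') => c; rewrite ler0n ler_nat.
  by case: c => -[|[i|p q|a p q|a p] k] s //=; exact: leq_b1.
- apply: (@expected_le _ _ _ L m1 nw' (running R (G := G))) => c.
  by rewrite ler0n lexx.
Qed.
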